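(* Let $n$ be a positive integer. Then the number of primitive Eisenstein circle packings with outer curvature $-n$ is $$\frac{n}{2}\prod_{p\mid n}\left(1-\left(\frac{-3}{p}\right)\frac1p\right)+2^{\omega(3n)-2}$$ if $n$ is odd, and $$\frac{n}{3}\prod_{p\mid n}\left(1-\left(\frac{-3}{p}\right)\frac1p\right)+2^{\omega(3n/2)-1}$$ if $n$ is even. Here $\omega(m)$ denotes the number of distinct prime factors of $m$, the products are over primes $p$ dividing $n$, and $\left(\frac{-3}{p}\right)\in\{-1,0,1\}$ is the Kronecker symbol, which satisfies $\left(\frac{-3}{p}\right)\equiv p\pmod 3$.
   Context: An Eisenstein quadruple is $(a,b,c,d)\in\mathbb{R}^4$ with $a^2+b^2+c^2+d^2=2(a+c)(b+d)$ and $a+b+c+d>0$; it is primitive if $a,b,c,d\in\mathbb{Z}$ have no common divisor. The four circle swaps act on Eisenstein quadruples by $S_1:(a,b,c,d)\mapsto(2b+2d-a,b,c,d)$, $S_2:(a,b,c,d)\mapsto(a,2a+2c-b,c,d)$, $S_3:(a,b,c,d)\mapsto(a,b,2b+2d-c,d)$, $S_4:(a,b,c,d)\mapsto(a,b,c,2a+2c-d)$. An Eisenstein quadruple is reduced if none of the swaps decreases $a+b+c+d$; a primitive one is in standard position if $a\equiv b$ and $c\equiv d\pmod2$. Oriented circles in $\widehat{\mathbb{C}}=\mathbb{C}\cup\{\infty\}$ (circles or lines with orientation, the interior being on the left) are represented by vectors $(u,v,p,q)\in\mathbb{R}^4$ with $p^2+q^2-uv=1$, where $u$ is the curvature (signed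 reciprocal of the radius, negative iff $\infty$ is in the interior, $0$ for lines), $v$ the co-curvature (curvature after $z\mapsto1/z$), and $p+qi$ the curvature-centre ($u$ times the centre if $u\neq0$, the unit normal from exterior to interior if $u=0$). Put $\langle(u_1,v_1,p_1,q_1),(u_2,v_2,p_2,q_2)\rangle=-\frac12u_1v_2-\frac12u_2v_1+p_1p_2+q_1q_2$. A 4-wheel is a 4-tuple $(\mathcal{C}_1,\mathcal{C}_2,\mathcal{C}_3,\mathcal{C}_4)$ of oriented circles with positive curvature sum such that $\langle\mathcal{C}_i,\mathcal{C}_i\rangle=1$ for all $i$, $\langle\mathcal{C}_1,\mathcal{C}_3\rangle=\langle\mathcal{C}_2,\mathcal{C}_4\rangle=-2$, and all other products are $-1$. The $i$-th swap of a 4-wheel replaces $\mathcal{C}_i$ by its image under inversion in the circle orthogonal to the other three; the result is again a 4-wheel, and its effect on curvatures is $S_i$. The Eisenstein circle packing generated by a 4-wheel $W$ is the collection of all circles occurring in 4-wheels obtained from $W$ by finite sequences of swaps. It is primitive if all curvatures are integers with no common factor. Packings are counted up to translation, rotation and reflection of the plane. Each primitive packing has a unique root quadruple: a reduced quadruple $(a,b,c,d)$ in standard position with $a\le0$ (obtained from a 4-wheel of the packing, up to relabelling by exchanging entries $1,3$, entries $2,4$, or the pairs $(1,3)$ and $(2,4)$), and the root quadruple determines the packing up to these motions. The outer curvature of the packing is $a$; when negative it is the unique negative curvature in the packing. *)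

(* Defs.v *)
From mathcomp Require Import all_boot all_order all_algebra.
From mathcomp Require Import all_classical all_reals.

Set Implicit Arguments.
Unset Strict Implicit.
Unset Printing Implicit Defensive.

Import Order.TTheory GRing.Theory Num.Theory.

Local Open Scope classical_set_scope.
Local Open Scope ring_scope.

(** * Eisenstein quadruples *)

(* Quadruples are real in general, and integral where divisibility is involved;
   hence the arbitrary numDomainType below. *)
Definition quad (T : Type) : Type := (T * T * T * T)%type.

Definition qsum (K : numDomainType) (x : quad K) : K :=
  let '(a, b, c, d) := x in a + b + c + d.

Definition eisenstein (K : numDomainType) (x : quad K) : Prop :=
  let '(a, b, c, d) := x in
  a ^+ 2 + b ^+ 2 + c ^+ 2 + d ^+ 2 = 2 * (a + c) * (b + d) /\ 0 < qsum x.

Definition S1 (K : numDomainType) (x : quad K) : quad K :=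
  let '(a, b, c, d) := x in (2 * b + 2 * d - a, b, c, d).
Definition S2 (K : numDomainType) (x : quad K) : quad K :=
  let '(a, b, c, d) := x in (a, 2 * a + 2 * c - b, c, d).
Definition S3 (K : numDomainType) (x : quad K) : quad K :=
  let '(a, b, c, d) := x in (a, b, 2 * b + 2 * d - c, d).
Definition S4 (K : numDomainType) (x : quad K) : quad K :=
  let '(a, b, c, d) := x in (a, b, c, 2 * a + 2 * c - d).

Definition reduced (K : numDomainType) (x : quad K) : Prop :=
  [/\ qsum x <= qsum (S1 x), qsum x <= qsum (S2 x),
      qsum x <= qsum (S3 x) & qsum x <= qsum (S4 x)].

Definition primitive_quad (x : quad int) : Prop :=
  let '(a, b, c, d) := x in gcdz (gcdz a b) (gcdz c d) = 1.

Definition standard_position (x : quad int) : Prop :=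
  let '(a, b, c, d) := x in (a = b %[mod 2])%Z /\ (c = d %[mod 2])%Z.

Inductive relabel (T : Type) : quad T -> quad T -> Prop :=
| relabel_refl x : relabel x x
| relabel_13 a b c d y : relabel (c, b, a, d) y -> relabel (a, b, c, d) y
| relabel_24 a b c d y : relabel (a, d, c, b) y -> relabel (a, b, c, d) y
| relabel_pairs a b c d y : relabel (b, a, d, c) y -> relabel (a, b, c, d) y.

(** * Oriented circles *)

(* An oriented circle is the vector (u, v, p, q) of its curvature, its
   co-curvature and the two coordinates of its curvature-centre; the constraint
   p^2 + q^2 - u v = 1 reads [cprod C C = 1].  The interior of the circle
   consists of the points (x, y) such that
     u (x^2 + y^2) - 2 (p x + q y) + v < 0
   (and of the point at infinity when u < 0). *)
Record circle (R : realType) := Circle {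
  curv : R;
  cocurv : R;
  cen_re : R;
  cen_im : R
}.

Definition cprod (R : realType) (C D : circle R) : R :=
  - (curv C * cocurv D) / 2 - (curv D * cocurv C) / 2
  + cen_re C * cen_re D + cen_im C * cen_im D.

(* The image of C under inversion in the circle O (with [cprod O O = 1]), the
   image being oriented so that its interior is the image of the interior of C:
   the vector C - 2 <C, O> O.  It does not depend on the orientation of O. *)
Definition inversion (R : realType) (O C : circle R) : circle R :=
  let k := 2 * cprod C O in
  Circle (curv C - k * curv O) (cocurv C - k * cocurv O)
         (cen_re C - k * cen_re O) (cen_im C - k * cen_im O).

(** * 4-wheels and packings *)

Definition curvatures (R : realType) (W : 'I_4 -> circle R) : quad R :=
  (curv (W 0), curv (W 1), curv (W 2), curv (W 3)).

Definition wheel (R : realType) (W : 'I_4 -> circle R) : Prop :=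
  0 < qsum (curvatures W) /\
  forall i j : 'I_4,
    cprod (W i) (W j) = if i == j then 1 else if odd (i + j)%N then -1 else -2.

Definition swap (R : realType) (i : 'I_4) (W W' : 'I_4 -> circle R) : Prop :=
  exists O : circle R,
    [/\ cprod O O = 1,
        forall j, j != i -> cprod O (W j) = 0,
        W' i = inversion O (W i) &
        forall j, j != i -> W' j = W j].

Inductive obtained (R : realType) (W : 'I_4 -> circle R) :
    ('I_4 -> circle R) -> Prop :=
| obtained_refl : obtained W W
| obtained_swap i W' W'' : obtained W W' -> swap i W' W'' -> obtained W W''.

Definition packing_of (R : realType) (W : 'I_4 -> circle R) : set (circle R) :=
  [set C | exists W' i, obtained W W' /\ C = W' i].

Definition packing (R : realType) (P : set (circle R)) : Prop :=
  exists W, wheel W /\ P = packing_of W.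

Definition primitive_packing (R : realType) (P : set (circle R)) : Prop :=
  [/\ packing P,
      forall C, P C -> curv C \is a Num.int &
      forall g : nat,
        (forall C, P C -> exists m : int, curv C = (g%:Z * m)%:~R) -> g = 1%N].

Definition quad_int (R : realType) (x : quad int) : quad R :=
  let '(a, b, c, d) := x in (a%:~R, b%:~R, c%:~R, d%:~R).

Arguments quad_int R x : clear implicits.

Definition root_quadruple (R : realType) (P : set (circle R)) (x : quad int)
    : Prop :=
  [/\ eisenstein x, primitive_quad x, reduced x, standard_position x &
      x.1.1.1 <= 0 /\
      exists W W', [/\ wheel W, P = packing_of W, obtained W W' &
                       relabel (curvatures W') (quad_int R x)]].

Definition outer_curvature (R : realType) (P : set (circle R)) (a : int)
    : Prop :=
  exists b c d : int, root_quadruple P (a, b, c, d).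

(** * Packings up to translation, rotation and reflection *)

(* The action of Euclidean motions on oriented circles; the interior of the
   image is the image of the interior. *)

Definition translate (R : realType) (x y : R) (C : circle R) : circle R :=
  Circle (curv C)
         (cocurv C + 2 * (x * cen_re C + y * cen_im C)
          + curv C * (x ^+ 2 + y ^+ 2))
         (cen_re C + curv C * x)
         (cen_im C + curv C * y).

(* z |-> (c + s i) z, for c^2 + s^2 = 1 *)
Definition rotate (R : realType) (c s : R) (C : circle R) : circle R :=
  Circle (curv C) (cocurv C)
         (c * cen_re C - s * cen_im C) (s * cen_re C + c * cen_im C).

(* complex conjugation *)
Definition reflect_conj (R : realType) (C : circle R) : circle R :=
  Circle (curv C) (cocurv C) (cen_re C) (- cen_im C).

(* Every composite of translations, rotations and reflections of the plane is
   z |-> e z + t or z |-> e (conj z) + t with |e| = 1. *)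
Definition motion (R : realType) (b : bool) (c s x y : R) (C : circle R)
    : circle R :=
  translate x y (rotate c s (if b then reflect_conj C else C)).

Definition congruent (R : realType) (P Q : set (circle R)) : Prop :=
  exists b c s x y, c ^+ 2 + s ^+ 2 = 1 /\ Q = motion b c s x y @` P.

Definition congruence_class (R : realType) (P : set (circle R))
    : set (set (circle R)) :=
  [set Q | congruent P Q].

Definition packing_classes (R : realType) (a : int)
    : set (set (set (circle R))) :=
  [set congruence_class P |
    P in [set P | primitive_packing P /\ outer_curvature P a]].
Arguments packing_classes R a : clear implicits.

(** * The arithmetic functions of the formula *)

(* The Kronecker symbol (a / p) for a prime p. *)
Definition kronecker (a : int) (p : nat) : int :=
  if (p %| a)%Z then 0
  else if p == 2%N then
    if ((a %% 8)%Z == 1) || ((a %% 8)%Z == 7) then 1 else -1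
  else if [exists x : 'I_p, (p %| (x%:Z ^+ 2 - a))%Z] then 1 else -1.

Definition omega (m : nat) : nat := size (primes m).

Definition euler_factor (n : nat) : rat :=
  \prod_(p <- primes n) (1 - (kronecker (-3) p)%:~R / p%:R).

(* Main.v *)
(** A root quadruple (-n, b, c, d) is b = 2A+n, d = D+n, c = 2A+D-B+2n for a
    primitive triple (D, B, A) with 4AD - B^2 = 3n^2, D odd, 0 <= B <= D and
    B <= 2A.  Then D X^2 + 2B XY + 4A Y^2 is the norm form x^2 + 3y^2 of
    Z[sqrt(-3)] restricted to a sublattice of index n, namely
    {u : n | det(u, z)} for a vector z of norm prime to n.  Reduction theory
    attaches to z a unique triple, and the triple determines z up to conjugation
    and scalars modulo n.  An orbit of z modulo n under scalars and conjugation
    has 2 phi(n) elements, or phi(n) if z is proportional to its conjugate, that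
    is if n | 2xy; hence 2 phi(n) times the number of triples is the number of
    pairs (x, y) modulo n of norm prime to n plus the number of those with
    n | 2xy.  Both counts are multiplicative in n.

    A swap replaces C_i by 2 C_(i-1) + 2 C_(i+1) - C_i.  Any 4-wheel of a packing
    descends to a given reduced one by swaps not increasing the curvature sum,
    and these never move a circle of negative curvature, so the outer circle C_1
    is determined by the packing.  If C is tangent to C_1 then C_1 + C is a null
    vector in the lattice spanned by the circles, and D and 2A are minimal
    curvatures of such vectors; so the packing determines (D, B, A), and
    conversely the curvatures of a 4-wheel determine it up to motions. *)

(* An even norm in Z[sqrt(-3)] is divisible by 4. So the lattices that occur have a basis with one
   odd vector v and one even vector w, whence the coefficients D and 4A and the base changes in
   which v enters w' with an even coefficient. In each class a reduced triple consists of the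
   minimal D, the minimal A, and the B >= 0 given by the discriminant; this characterisation is used
   for forms and again for packings, and avoids a discussion of boundary cases. The point z exists
   because for n = 1 there is a single class of forms; it is unique up to scalars and conjugation
   because the only units of Z[sqrt(-3)] are 1 and -1. The factor n/3 for even n comes from the
   prime 2: two of the four pairs modulo 2 have odd norm, where the Euler product would predict
   three. For packings the obstacle is that a packing is a bare set of circles, without the swaps
   that produced it. Once the outer circle is recognised, two root wheels of one packing are
   compared through integral coordinates of one in the other, and the two resulting inequalities are
   symmetric. *)
Require Import Defs.
From mathcomp Require Import all_boot all_order all_algebra.
From mathcomp Require Import all_classical all_reals.
From mathcomp Require Import ring lra zify.
Import Order.TTheory GRing.Theory Num.Theory.
Local Open Scope ring_scope.

(** * Reduction of binary forms *)

Section BinaryForms.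
Implicit Types D B A X Y Z T : int.

(* (D, B, A) stands for the form D X^2 + 2 B X Y + 4 A Y^2 in a basis (v, w); the
   admissible changes of basis are v' = X v + Y w, w' = 2 Z v + T w. *)
Definition qformD D B A X Y := D * X ^+ 2 + 2 * B * X * Y + 4 * A * Y ^+ 2.
Definition qformB D B A X Y Z T :=
  2 * D * X * Z + B * (X * T + 2 * Y * Z) + 4 * A * Y * T.
Definition qformA D B A Z T := D * Z ^+ 2 + B * Z * T + A * T ^+ 2.

Definition reduced_form D B A := [&& 0 <= B, B <= D & B <= 2 * A].

Lemma reduce_form D B A : 0 < D -> 0 < A -> B ^+ 2 < 4 * A * D ->
  exists X Y Z T, (X * T - 2 * Y * Z) ^+ 2 = 1 /\
    reduced_form (qformD D B A X Y) (qformB D B A X Y Z T) (qformA D B A Z T).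
Proof.
have [m] := ubnP `|(D + A)%R|%N.
elim: m => // m IH in D B A *; move=> lem D0 A0 disc.
have shiftA k : let A' := D * k ^+ 2 + B * k + A in A' < A ->
    exists X Y Z T, (X * T - 2 * Y * Z) ^+ 2 = 1 /\
    reduced_form (qformD D B A X Y) (qformB D B A X Y Z T) (qformA D B A Z T).
  move=> A' ltA.
  have A'0 : 0 < A'.
    have : 0 < 4 * D * A'.
      have -> : 4 * D * A' = (4 * A * D - B ^+ 2) + (2 * D * k + B) ^+ 2.
        by rewrite /A'; ring.
      by rewrite ltr_wpDr ?sqr_ge0 // subr_gt0.
    by rewrite pmulr_rgt0 // mulr_gt0.
  have [||//||X [Y [Z [T [u r]]]]] := IH D (B + 2 * D * k) A'.
  - by clearbody A'; lia.
  - by [].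
  - by rewrite -subr_gt0 [ltRHS](_ : _ = 4 * A * D - B ^+ 2) ?subr_gt0 // /A'; ring.
  exists (X + 2 * k * Y), Y, (Z + k * T), T; split.
    by apply: etrans u; congr (_ ^+ 2); ring.
  move: r; rewrite /qformD /qformB /qformA /A'.
  by congr (reduced_form _ _ _); ring.
have shiftD k : let D' := D + 2 * B * k + 4 * A * k ^+ 2 in D' < D ->
    exists X Y Z T, (X * T - 2 * Y * Z) ^+ 2 = 1 /\
    reduced_form (qformD D B A X Y) (qformB D B A X Y Z T) (qformA D B A Z T).
  move=> D' ltD.
  have D'0 : 0 < D'.
    have : 0 < 4 * A * D'.
      have -> : 4 * A * D' = (4 * A * D - B ^+ 2) + (4 * A * k + B) ^+ 2.
        by rewrite /D'; ring.
      by rewrite ltr_wpDr ?sqr_ge0 // subr_gt0.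
    by rewrite pmulr_rgt0 // mulr_gt0.
  have [||//||X [Y [Z [T [u r]]]]] := IH D' (B + 4 * A * k) A.
  - by clearbody D'; lia.
  - by [].
  - by rewrite -subr_gt0 [ltRHS](_ : _ = 4 * A * D - B ^+ 2) ?subr_gt0 // /D'; ring.
  exists X, (Y + k * X), Z, (T + 2 * k * Z); split.
    by apply: etrans u; congr (_ ^+ 2); ring.
  move: r; rewrite /qformD /qformB /qformA /D'.
  by congr (reduced_form _ _ _); ring.
have [lt|leD] := ltP D B; first by apply: (shiftA (- 1)); lia.
have [lt|leD'] := ltP B (- D); first by apply: (shiftA 1); lia.
have [lt|leA] := ltP (2 * A) B; first by apply: (shiftD (- 1)); lia.
have [lt|leA'] := ltP B (- (2 * A)); first by apply: (shiftD 1); lia.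
have [B0|B0] := leP 0 B.
  by exists 1, 0, 0, 1; rewrite /reduced_form /qformD /qformB /qformA; lia.
by exists 1, 0, 0, (- 1); rewrite /reduced_form /qformD /qformB /qformA; lia.
Qed.

(** For a reduced triple the form is a combination of X^2, 2 Y^2 and (X + Y)^2 + Y^2 with the
    nonnegative coefficients D - B, 2A - B and B; if X is nonzero, the first and the third of these
    are at least 1. *)
Lemma reduced_form_minD D B A X Y :
  reduced_form D B A -> X != 0 -> D <= qformD D B A X Y.
Proof.
case/and3P=> B0 BD BA X0.
have -> : qformD D B A X Y = (D - B) * X ^+ 2 + (2 * A - B) * (2 * Y ^+ 2)
   + B * ((X + Y) ^+ 2 + Y ^+ 2) by rewrite /qformD; ring.
have X1 : 1 <= X ^+ 2 by rewrite -gtz0_ge1 exprn_even_gt0.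
have S1 : 1 <= (X + Y) ^+ 2 + Y ^+ 2.
  have [->|Y0] := eqVneq Y 0; first by rewrite expr0n !addr0.
  by rewrite -[1]add0r lerD ?sqr_ge0 // -gtz0_ge1 exprn_even_gt0.
have h1 : 0 <= (D - B) * (X ^+ 2 - 1) by rewrite mulr_ge0 ?subr_ge0.
have h2 : 0 <= (2 * A - B) * (2 * Y ^+ 2).
  by rewrite mulr_ge0 ?subr_ge0 // mulr_ge0 ?sqr_ge0.
have h3 : 0 <= B * ((X + Y) ^+ 2 + Y ^+ 2 - 1) by rewrite mulr_ge0 // subr_ge0.
lia.
Qed.

Lemma reduced_form_minA D B A Z T :
  reduced_form D B A -> T != 0 -> A <= qformA D B A Z T.
Proof.
case/and3P=> B0 BD BA T0.
have T1 : 1 <= T ^+ 2 by rewrite -gtz0_ge1 exprn_even_gt0.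
have S1 : 1 <= (Z + T) ^+ 2 + Z ^+ 2.
  have [->|Y0] := eqVneq Z 0; first by rewrite expr0n add0r addr0.
  by rewrite -[1]add0r lerD ?sqr_ge0 // -gtz0_ge1 exprn_even_gt0.
have h1 : 0 <= (2 * A - B) * (T ^+ 2 - 1) by rewrite mulr_ge0 ?subr_ge0.
have h2 : 0 <= (D - B) * Z ^+ 2 by rewrite mulr_ge0 ?subr_ge0 ?sqr_ge0.
have h3 : 0 <= B * ((Z + T) ^+ 2 + Z ^+ 2 - 1) by rewrite mulr_ge0 // subr_ge0.
have : 2 * qformA D B A Z T = (2 * A - B) * T ^+ 2 + 2 * ((D - B) * Z ^+ 2)
   + B * ((Z + T) ^+ 2 + Z ^+ 2) by rewrite /qformA; ring.
lia.
Qed.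

Lemma unimodular_neq0 X Y Z T :
  (X * T - 2 * Y * Z) ^+ 2 = 1 -> (X != 0) && (T != 0).
Proof.
move/eqP; rewrite sqrf_eq1 => u; apply/andP; split; apply/eqP => e;
by move: u; rewrite e ?mulr0 ?mul0r; lia.
Qed.

Lemma reduced_form_le D B A X Y Z T :
  reduced_form D B A -> (X * T - 2 * Y * Z) ^+ 2 = 1 ->
  D <= qformD D B A X Y /\ A <= qformA D B A Z T.
Proof.
move=> r /unimodular_neq0 /andP[X0 T0].
by split; [apply: reduced_form_minD|apply: reduced_form_minA].
Qed.

Lemma form_inverse D B A X Y Z T : (X * T - 2 * Y * Z) ^+ 2 = 1 ->
  let D' := qformD D B A X Y in let B' := qformB D B A X Y Z T in
  let A' := qformA D B A Z T in
  [/\ D = qformD D' B' A' T (- Y), B = qformB D' B' A' T (- Y) (- Z) X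
    & A = qformA D' B' A' (- Z) X].
Proof.
move=> u; rewrite /qformD /qformB /qformA.
(* Multiplying by the squared determinant turns each equation into a polynomial identity. *)
have mu K : K = K * (X * T - 2 * Y * Z) ^+ 2 by rewrite u mulr1.
by split; rewrite [LHS]mu; ring.
Qed.

(** Minimality of D and A, applied to the base change and to its inverse, gives inequalities both
    ways; B then follows from the discriminant and B >= 0. *)
Lemma reduced_form_uniq D B A X Y Z T :
  (X * T - 2 * Y * Z) ^+ 2 = 1 ->
  let D' := qformD D B A X Y in let B' := qformB D B A X Y Z T in
  let A' := qformA D B A Z T in
  reduced_form D B A -> reduced_form D' B' A' -> [/\ D' = D, B' = B & A' = A].
Proof.
move=> u D' B' A' r r'.
have u' : (T * X - 2 * (- Y) * (- Z)) ^+ 2 = 1 by apply: etrans u; congr (_ ^+ 2); ring.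
have [eD eB eA] := form_inverse D B A _ _ _ _ u.
have [h1 h2] := reduced_form_le _ _ _ _ _ _ _ r u.
have [h3 h4] := reduced_form_le _ _ _ _ _ _ _ r' u'.
rewrite -eD in h3; rewrite -eA in h4.
have e1 : D' = D by apply/eqP; rewrite eq_le h1 h3.
have e2 : A' = A by apply/eqP; rewrite eq_le h2 h4.
split=> //.
have disc : 4 * A' * D' - B' ^+ 2 = 4 * A * D - B ^+ 2.
  by rewrite -[RHS]mulr1 -[X in _ = _ * X]u /D' /B' /A' /qformD /qformB /qformA; ring.
have /andP[B0 _] := r; have /andP[B'0 _] := r'.
apply/eqP; rewrite -(eqrXn2 (isT : (0 < 2)%N)) //; apply/eqP.
by move: disc; rewrite e1 e2 => /addrI/oppr_inj.
Qed.
End BinaryForms.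

(** * Sublattices of Z[sqrt(-3)] *)

Section Lattices.
Implicit Types (D B A X Y Z T n : int) (u v w z : int * int).

(** A pair v stands for v.1 + v.2 sqrt(-3). The product of v with the conjugate of w has coordinates
    [dot v w] and [- det2 v w], which is why [nrm_mul] holds. *)
Definition nrm v := v.1 ^+ 2 + 3 * v.2 ^+ 2.
Definition dot v w := v.1 * w.1 + 3 * v.2 * w.2.
Definition det2 v w := v.1 * w.2 - v.2 * w.1.
Definition conj2 v : int * int := (v.1, - v.2).
Definition comb X v Y w : int * int := (X * v.1 + Y * w.1, X * v.2 + Y * w.2).

Definition disc_form n D B A :=
  [&& 4 * A * D == B ^+ 2 + 3 * n ^+ 2, ~~ (2 %| D)%Z & gcdz D (gcdz B A) == 1].

(** For z of norm prime to n, v and w are automatically a basis of the lattice of all u with n |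
    [det2 u z]: that lattice has index n, and [disc_form] forces [det2 v w] to be n up to sign. *)
Definition represents n D B A z := exists v w,
  [/\ nrm v = D, dot v w = B, nrm w = 4 * A & (n %| det2 v z)%Z /\ (n %| det2 w z)%Z].

Lemma nrm_mul v w : nrm v * nrm w = dot v w ^+ 2 + 3 * det2 v w ^+ 2.
Proof. by rewrite /nrm /dot /det2; ring. Qed.

(** Since [nrm z] is invertible modulo n, two vectors proportional to z modulo n are proportional to
    each other. *)
Lemma det_dvd n u v z : coprimez n (nrm z) ->
  (n %| det2 u z)%Z -> (n %| det2 v z)%Z -> (n %| det2 u v)%Z.
Proof.
move=> co uz vz; rewrite -(Gauss_dvdzr _ co).
have -> : nrm z * det2 u v = dot v z * det2 u z - dot u z * det2 v z.
  by rewrite /nrm /dot /det2; ring.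
by rewrite rpredB ?dvdz_mull.
Qed.

Lemma det2C u v : det2 u v = - det2 v u.
Proof. by rewrite /det2; ring. Qed.

Lemma nrm_conj v : nrm (conj2 v) = nrm v.
Proof. by rewrite /nrm /conj2 /=; ring. Qed.

Lemma represents_conj n D B A z :
  represents n D B A z -> represents n D B A (conj2 z).
Proof.
case=> v [w [<- <- e [vz wz]]]; exists (conj2 v), (conj2 w).
rewrite !nrm_conj e; split=> //; first by rewrite /dot /conj2 /=; ring.
suff h u : (n %| det2 u z)%Z -> (n %| det2 (conj2 u) (conj2 z))%Z by split; exact: h.
have -> : det2 (conj2 u) (conj2 z) = - det2 u z by rewrite /det2 /conj2 /=; ring.
by rewrite rpredN.
Qed.

Lemma represents_congr n D B A z z' : coprimez n (nrm z) -> (n %| det2 z z')%Z ->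
  represents n D B A z -> represents n D B A z'.
Proof.
move=> co d [v [w [? ? ? [vz wz]]]]; exists v, w; split=> //.
by split; apply: (det_dvd _ _ _ z) => //; rewrite det2C rpredN.
Qed.

Lemma disc_det n D B A v w : disc_form n D B A -> nrm v = D -> dot v w = B ->
  nrm w = 4 * A -> (det2 v w) ^+ 2 = n ^+ 2.
Proof.
case/and3P=> /eqP disc _ _ eD eB eA; have := nrm_mul v w.
by rewrite eD eB eA [D * _]mulrC disc => /addrI; lia.
Qed.

Lemma disc_form_pos n D B A : 0 < n -> disc_form n D B A -> 0 <= D -> 0 < D /\ 0 < A.
Proof.
move=> n0 /and3P[/eqP disc oD _] D0.
have {}D0 : 0 < D by rewrite lt_neqAle D0 andbT; apply: contraNneq oD => <-.
split=> //; have : 0 < 4 * A * D.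
  by rewrite disc ltr_wpDl ?sqr_ge0 // mulr_gt0 // exprn_gt0.
by rewrite pmulr_lgt0 // pmulr_rgt0.
Qed.

Lemma prim_primeP D B A : ~~ (2 %| D)%Z ->
  reflect (forall p : nat, prime p -> (p %| D)%Z -> (p %| B)%Z -> (p %| A)%Z -> False)
   (gcdz D (gcdz B A) == 1).
Proof.
move=> oD; apply: (iffP eqP) => [g1 p pp pD pB pA|h].
  have : (p %| gcdz D (gcdz B A))%Z by rewrite !dvdz_gcd pD pB pA.
  by rewrite g1 dvdzE /= dvdn1 => /eqP p1; rewrite p1 in pp.
have [g1|g1] := eqVneq (absz (gcdz D (gcdz B A))) 1%N.
  by rewrite -[LHS]gez0_abs ?g1 // .
have pp := pdiv_prime (n := absz (gcdz D (gcdz B A))).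
have D0 : D != 0 by apply: contraNneq oD => ->.
have {}pp : prime (pdiv (absz (gcdz D (gcdz B A)))).
  by apply: pp; rewrite ltn_neqAle eq_sym g1 absz_gt0 gcdz_eq0 negb_and D0.
have : ((pdiv (absz (gcdz D (gcdz B A)))) %| (gcdz D (gcdz B A)))%Z.
  by rewrite dvdzE /= pdiv_dvd.
rewrite !dvdz_gcd => /and3P[pD pB pA].
by have := h _ pp pD pB pA.
Qed.

Lemma dvd_lincomb v w z : det2 v w != 0 -> (det2 v w %| det2 v z)%Z ->
  (det2 v w %| det2 w z)%Z -> exists X Y, z = comb X v Y w.
Proof.
move=> d0 /dvdzP[Y eY] /dvdzP[X eX]; exists (- X), Y.
have h1 : det2 v w * z.1 = det2 v w * (comb (- X) v Y w).1.
  transitivity (det2 v z * w.1 - det2 w z * v.1); first by rewrite /det2; ring.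
  by rewrite eX eY /comb /=; ring.
have h2 : det2 v w * z.2 = det2 v w * (comb (- X) v Y w).2.
  transitivity (det2 v z * w.2 - det2 w z * v.2); first by rewrite /det2; ring.
  by rewrite eX eY /comb /=; ring.
by rewrite [z]surjective_pairing (mulfI d0 h1) (mulfI d0 h2) /comb.
Qed.

Lemma dvd_det_sqr n a : a ^+ 2 = n ^+ 2 -> forall b, (a %| b)%Z = (n %| b)%Z.
Proof.
move/eqP; rewrite eqf_sqr => /orP[/eqP->//|/eqP-> b].
by rewrite !dvdzE abszN.
Qed.

Lemma nrm_comb X v Y w :
  nrm (comb X v Y w) = nrm v * X ^+ 2 + 2 * dot v w * X * Y + nrm w * Y ^+ 2.
Proof. by rewrite /nrm /dot /comb /=; ring. Qed.

Lemma dot_comb X v Y w X' Y' :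
  dot (comb X v Y w) (comb X' v Y' w) =
  nrm v * X * X' + dot v w * (X * Y' + X' * Y) + nrm w * Y * Y'.
Proof. by rewrite /nrm /dot /comb /=; ring. Qed.

Lemma det_comb X v Y w X' Y' :
  det2 (comb X v Y w) (comb X' v Y' w) = (X * Y' - Y * X') * det2 v w.
Proof. by rewrite /det2 /comb /=; ring. Qed.

Lemma det_combl X v Y w z :
  det2 (comb X v Y w) z = X * det2 v z + Y * det2 w z.
Proof. by rewrite /det2 /comb /=; ring. Qed.

(** Otherwise p^2, which divides 4AD - B^2 = 3n^2, would divide 3. *)
Lemma prime_dvd_disc (p : nat) n D B A : prime p -> 4 * A * D = B ^+ 2 + 3 * n ^+ 2 ->
  (p %| D)%Z -> (p %| B)%Z -> (p %| A)%Z -> (p %| n)%Z.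
Proof.
move=> pp disc /dvdzP[D' eD] /dvdzP[B' eB] /dvdzP[A' eA]; apply: contraLR isT => pn.
have : coprimez (p%:Z ^+ 2) (n ^+ 2).
  by rewrite coprimezXl // coprimezXr // coprimezE /= prime_coprime // -dvdzE.
have : (p%:Z ^+ 2 %| 3 * n ^+ 2)%Z.
  apply/dvdzP; exists (4 * A' * D' - B' ^+ 2).
  have -> : 3 * n ^+ 2 = 4 * A * D - B ^+ 2 by rewrite disc; ring.
  by rewrite eD eB eA; ring.
move=> h co; move: h; rewrite (Gauss_dvdzl _ co) dvdzE abszX /=.
move/dvdn_leq => /(_ isT); have := prime_gt1 pp; nia.
Qed.

Lemma even_neq_unit (k : int) : ~~ ((k * 2 == 1) || (k * 2 == - 1)).
Proof. by lia. Qed.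

Lemma represents_odd n z : 0 < n -> coprimez n (nrm z) -> ~~ (2 %| nrm z)%Z ->
  exists D B A, [/\ disc_form n D B A, reduced_form D B A & represents n D B A z].
Proof.
move=> n0 co oz.
pose g := gcdz z.1 z.2.
have [a ea] := dvdzP (dvdz_gcdl z.1 z.2).
have [b eb] := dvdzP (dvdz_gcdr z.1 z.2).
rewrite -/g in ea eb.
have g0 : g != 0.
  apply: contraNneq oz => g0; rewrite /nrm ea eb g0; apply/dvdzP; exists 0; ring.
have [c [d cd]] := Bezoutz z.1 z.2.
have {}cd : c * a + d * b = 1.
  apply: (mulIf g0); rewrite mul1r -[RHS]cd ea eb; ring.
pose v := (a, b).
(* The vector (-nd, nc) completes v to determinant n because ca + db = 1. As a + b is odd, adding v
   when necessary makes w.1 + w.2 even, and then 4 divides [nrm w]. *)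
pose k : int := if (2 %| (n * c + n * d))%Z then 0 else 1.
pose w := (- n * d + k * a, n * c + k * b).
have ez : nrm z = g ^+ 2 * nrm v by rewrite /nrm ea eb /v /=; ring.
have ov : ~~ (2 %| nrm v)%Z by apply: contraNN oz; rewrite ez => /dvdz_mull ->.
have dvw : det2 v w = n.
  by rewrite /det2 /v /w /= -[RHS]mulr1 -[X in _ = _ * X]cd; ring.
have vz : (n %| det2 v z)%Z.
  by have -> : det2 v z = 0 by rewrite /det2 ea eb /v /=; ring.
have wz : (n %| det2 w z)%Z.
  have -> : det2 w z = - (g * n) * (c * a + d * b) by rewrite /det2 ea eb /w /=; ring.
  by rewrite dvdz_mulr // rpredN dvdz_mull.
have oab : ~~ (2 %| a + b)%Z.
  apply: contraNN ov => /dvdzP[q e]; rewrite /nrm /v /=; apply/dvdzP.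
  have -> : a = q * 2 - b by lia.
  by exists (2 * q ^+ 2 - 2 * q * b + 2 * b ^+ 2); ring.
have : (2 %| w.1 + w.2)%Z.
  have -> : w.1 + w.2 = (n * c + n * d) + k * (a + b) - 2 * (n * d) by rewrite /w /=; ring.
  by rewrite /k; case: ifP => h; move: (n * c) (n * d) h oab; lia.
case/dvdzP=> q eq.
pose A := q ^+ 2 - q * w.2 + w.2 ^+ 2.
have ew : nrm w = 4 * A.
  have e : w.1 = q * 2 - w.2 by rewrite -eq; ring.
  by rewrite /nrm /A e; ring.
have disc : 4 * A * nrm v = dot v w ^+ 2 + 3 * n ^+ 2.
  by rewrite -ew -[n in RHS]dvw -nrm_mul mulrC.
have D0 : 0 < nrm v.
  have : 0 <= nrm v by apply: addr_ge0; [exact: sqr_ge0|rewrite pmulr_rge0 ?sqr_ge0].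
  by rewrite le_eqVlt => /orP[/eqP e|//]; rewrite -e in ov.
have AD0 : 0 < 4 * A * nrm v.
  by rewrite disc ltr_wpDl ?sqr_ge0 // mulr_gt0 // exprn_gt0.
have A0 : 0 < A by move: AD0; rewrite pmulr_lgt0 // pmulr_rgt0.
have [||//|X [Y [Z [T [u r]]]]] := reduce_form (nrm v) (dot v w) A.
- by [].
- by [].
- by rewrite disc ltrDl mulr_gt0 // exprn_gt0.
set D' := qformD _ _ _ _ _ in r; set B' := qformB _ _ _ _ _ _ _ in r.
set A' := qformA _ _ _ _ _ in r.
pose v' := comb X v Y w; pose w' := comb (2 * Z) v T w.
have ev' : nrm v' = D' by rewrite nrm_comb ew /D' /qformD.
have ed' : dot v' w' = B' by rewrite dot_comb ew /B' /qformB; ring.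
have ew' : nrm w' = 4 * A' by rewrite nrm_comb ew /A' /qformA; ring.
have det' : det2 v' w' ^+ 2 = n ^+ 2.
  by rewrite det_comb exprMn dvw -[RHS]mul1r -[X in _ = X * _]u; ring.
have v'z : (n %| det2 v' z)%Z by rewrite det_combl rpredD // dvdz_mull.
have w'z : (n %| det2 w' z)%Z by rewrite det_combl rpredD // dvdz_mull.
have disc' : 4 * A' * D' = B' ^+ 2 + 3 * n ^+ 2.
  by rewrite -ew' -ed' -ev' -det' -nrm_mul mulrC.
have oD' : ~~ (2 %| D')%Z.
  have /andP[X0 T0] := unimodular_neq0 _ _ _ _ u.
  have oX : ~~ (2 %| X)%Z.
    apply/negP => /dvdzP[x e]; move/eqP: u; rewrite e sqrf_eq1.
    have -> : x * 2 * T - 2 * Y * Z = (x * T - Y * Z) * 2 by ring.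
    exact/negP/even_neq_unit.
  rewrite /D' /qformD; apply/negP => h.
  have : (2 %| nrm v * X ^+ 2)%Z.
    have -> : nrm v * X ^+ 2 = nrm v * X ^+ 2 + 2 * dot v w * X * Y + 4 * A * Y ^+ 2 -
      (dot v w * X * Y + 2 * A * Y ^+ 2) * 2 by ring.
    by rewrite rpredB // dvdz_mull.
  move: ov oX; rewrite !dvdzE abszM abszX Euclid_dvdM // Euclid_dvdX //= andbT.
  by move=> /negbTE-> /negbTE->.
exists D', B', A'; split=> //; last by exists v', w'.
(* A common prime of the three coefficients divides n, and it divides [nrm z] too because z is in
   the span of v' and w'; this contradicts coprimality. *)
rewrite /disc_form disc' eqxx oD' /=; apply/(prim_primeP _ _ _ oD') => p pp pD pB pA.
have pn := prime_dvd_disc _ _ _ _ _ pp disc' pD pB pA.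
have d0 : det2 v' w' != 0 by rewrite -sqrf_eq0 det' sqrf_eq0 gt_eqF.
have [||s [t e]] := dvd_lincomb _ _ z d0; rewrite ?(dvd_det_sqr _ _ det') //.
have : (p %| nrm z)%Z.
  rewrite e nrm_comb ev' ed' ew' !rpredD //; first by rewrite dvdz_mulr.
    by rewrite -!mulrA dvdz_mull // dvdz_mulr.
  by rewrite -!mulrA dvdz_mull // dvdz_mulr.
move=> pz; have : (p %| gcdz n (nrm z))%Z by rewrite dvdz_gcd pn pz.
rewrite (eqP co) dvdzE dvdn1 => /eqP /= p1; by rewrite p1 in pp.
Qed.
End Lattices.

Section LatticesB.
Implicit Types (D B A X Y Z T n : int) (u v w z : int * int).

Lemma represents_ex n z : 0 < n -> coprimez n (nrm z) ->
  exists D B A, [/\ disc_form n D B A, reduced_form D B A & represents n D B A z].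
Proof.
move=> n0 co; have [ez|oz] := boolP (2 %| nrm z)%Z; last exact: represents_odd.
have on : ~~ (2 %| n)%Z.
  apply/negP => en; have : (2 %| gcdz n (nrm z))%Z by rewrite dvdz_gcd en ez.
  by rewrite (eqP co).
(* Here n is odd, so this shift changes the parity of the norm and keeps z modulo n. *)
pose z' := (z.1 + n, z.2).
have e' : nrm z' = nrm z + n * (2 * z.1 + n) by rewrite /nrm /=; ring.
have co' : coprimez n (nrm z').
  by rewrite e' addrC /coprimez mulrC gcdzMDl.
have oz' : ~~ (2 %| nrm z')%Z.
  apply: contraNN on => h.
  have : (2 %| n ^+ 2)%Z.
    have -> : n ^+ 2 = nrm z' - nrm z - 2 * (n * z.1) by rewrite e'; ring.
    by rewrite !rpredB // dvdz_mulr.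
  by rewrite !dvdzE abszX Euclid_dvdX // => /andP[].
have [D [B [A [h1 h2 h3]]]] := represents_odd _ _ n0 co' oz'.
exists D, B, A; split=> //; apply: represents_congr h3 => //.
have -> : det2 z' z = n * z.2 by rewrite /det2 /=; ring.
exact: dvdz_mulr.
Qed.

Lemma lattice_span n v w u : 0 < n -> det2 v w ^+ 2 = n ^+ 2 ->
  (n %| det2 v u)%Z -> (n %| det2 w u)%Z -> exists X Y, u = comb X v Y w.
Proof.
move=> n0 det vu wu; apply: dvd_lincomb; rewrite ?(dvd_det_sqr _ _ det) //.
by rewrite -sqrf_eq0 det sqrf_eq0 gt_eqF.
Qed.

Lemma represents_uniq n z D B A D' B' A' : 0 < n -> coprimez n (nrm z) ->
  disc_form n D B A -> reduced_form D B A -> represents n D B A z ->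
  disc_form n D' B' A' -> reduced_form D' B' A' -> represents n D' B' A' z ->
  [/\ D' = D, B' = B & A' = A].
Proof.
move=> n0 co d r [v [w [ev evw ew [vz wz]]]] d' r' [v' [w' [ev' evw' ew' [vz' wz']]]].
have det := disc_det _ _ _ _ _ _ d ev evw ew.
have det' := disc_det _ _ _ _ _ _ d' ev' evw' ew'.
have span u : (n %| det2 u z)%Z -> exists X Y, u = comb X v Y w.
  by move=> uz; apply: (lattice_span n) => //; apply: (det_dvd _ _ _ z).
have [X [Y e]] := span _ vz'; have [Z2 [T e2]] := span _ wz'.
(* The norm of w' is even and D is odd, so v enters w' with an even coefficient: the base change is
   admissible. *)
have : (2 %| Z2)%Z.
  have : (2 %| D * Z2 ^+ 2)%Z.
    have -> : D * Z2 ^+ 2 = (2 * A' - B * Z2 * T - 2 * A * T ^+ 2) * 2.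
      move: ew'; rewrite e2 nrm_comb ev evw ew => h.
      have -> : D * Z2 ^+ 2 = (D * Z2 ^+ 2 + 2 * B * Z2 * T + 4 * A * T ^+ 2)
         - 2 * B * Z2 * T - 4 * A * T ^+ 2 by ring.
      by rewrite h; ring.
    exact: dvdz_mull.
  have /and3P[_ oD _] := d; move: oD.
  by rewrite !dvdzE abszM abszX Euclid_dvdM // Euclid_dvdX //= andbT => /negbTE->.
case/dvdzP => Z eZ.
have u : (X * T - 2 * Y * Z) ^+ 2 = 1.
  have n2 : n ^+ 2 != 0 by rewrite sqrf_eq0 gt_eqF.
  apply: (mulIf n2); rewrite mul1r -[RHS]det' e e2 det_comb eZ exprMn det; ring.
have eD : D' = qformD D B A X Y.
  by rewrite -ev' e nrm_comb ev evw ew /qformD.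
have eB : B' = qformB D B A X Y Z T.
  by rewrite -evw' e e2 dot_comb ev evw ew eZ /qformB; ring.
have eA : A' = qformA D B A Z T.
  apply: (mulfI (_ : 4 != 0)) => //.
  by rewrite -ew' e2 nrm_comb ev evw ew eZ /qformA; ring.
by move: r'; rewrite eD eB eA; exact: reduced_form_uniq.
Qed.

(** The linear map taking v, w to v', w' preserves norm and orientation, so it is multiplication by
    an element of Q(sqrt(-3)) of norm 1. That element turns out to be integral, hence 1 or -1, and
    so z itself lies in the lattice of z'. *)
Lemma unit_rotation v w v' w' z z' n :
  0 < n -> nrm v = nrm v' -> dot v w = dot v' w' -> nrm w = nrm w' ->
  det2 v w = det2 v' w' -> det2 v w ^+ 2 = n ^+ 2 ->
  coprimez n (nrm z) -> coprimez n (nrm z') -> 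
  (n %| det2 v z)%Z -> (n %| det2 w z)%Z ->
  (n %| det2 v' z')%Z -> (n %| det2 w' z')%Z -> (n %| det2 z z')%Z.
Proof.
move=> n0 ev evw ew edet det co co' vz wz vz' wz'.
have [X [Y e]] := lattice_span _ _ _ _ n0 det vz wz.
(* The vector n lies in every lattice of this kind; if s is its image, the multiplier is s / n. *)
have dvdn u : (n %| det2 u (n, 0))%Z.
  have -> : det2 u (n, 0) = - u.2 * n by rewrite /det2 /=; ring.
  by rewrite dvdz_mull.
have [X' [Y' e']] := lattice_span _ _ _ _ n0 det (dvdn v) (dvdn w).
pose t := comb X v' Y w'; pose s := comb X' v' Y' w'.
have et : nrm t = nrm z by rewrite e !nrm_comb ev evw ew.
have est : dot s t = n * z.1.
  transitivity (dot (n, 0) z); last by rewrite /dot /=; ring.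
  by rewrite e e' !dot_comb ev evw ew.
have dst : det2 s t = n * z.2.
  transitivity (det2 (n, 0) z); last by rewrite /det2 /=; ring.
  by rewrite e e' !det_comb edet.
have [a [b ab]] := Bezoutz n (nrm z).
have {}ab : a * n + b * nrm z = 1 by rewrite ab; exact/eqP.
have es : nrm s = n ^+ 2.
  transitivity (nrm (n, 0)); last by rewrite /nrm /=; ring.
  by rewrite e' !nrm_comb ev evw ew.
have n2 : n != 0 by rewrite gt_eqF.
have h1 : n * t.1 = s.1 * z.1 - 3 * s.2 * z.2.
  apply: (mulfI n2).
  transitivity (s.1 * (n * z.1) - 3 * s.2 * (n * z.2)); last by ring.
  transitivity (n ^+ 2 * t.1); first by ring.
  by rewrite -es -est -dst /nrm /dot /det2; ring.
have h2 : n * t.2 = s.1 * z.2 + s.2 * z.1.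
  apply: (mulfI n2).
  transitivity (s.1 * (n * z.2) + s.2 * (n * z.1)); last by ring.
  transitivity (n ^+ 2 * t.2); first by ring.
  by rewrite -es -est -dst /nrm /dot /det2; ring.
have [nz|nz] := eqVneq (nrm z) 0.
  by move: co; rewrite nz /coprimez gcdz0 gtz0_abs // => /eqP ->; rewrite dvd1z.
(* [(p, q)] is the quotient t / z, integral because n and nrm z clear its denominator *)
pose p := a * s.1 + b * dot t z; pose q := a * s.2 + b * (t.2 * z.1 - t.1 * z.2).
have e1 : t.1 = p * z.1 - 3 * q * z.2.
  transitivity (a * (n * t.1) + b * nrm z * t.1).
    by rewrite -[LHS]mul1r -ab; ring.
  by rewrite h1 /p /q /dot /nrm; ring.
have e2 : t.2 = p * z.2 + q * z.1.
  transitivity (a * (n * t.2) + b * nrm z * t.2).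
    by rewrite -[LHS]mul1r -ab; ring.
  by rewrite h2 /p /q /dot /nrm; ring.
have pq : p ^+ 2 + 3 * q ^+ 2 = 1.
  apply: (mulIf nz); rewrite mul1r -[RHS]et /nrm e1 e2; ring.
(* A nonzero q would already give norm at least 3. *)
have q0 : q = 0.
  apply/eqP/contraT => q0; have : 1 <= q ^+ 2 by rewrite -gtz0_ge1 exprn_even_gt0.
  by have := sqr_ge0 p; move: pq; move: (p ^+ 2) (q ^+ 2) => P Q; clear; lia.
have dt : (n %| det2 t z')%Z by rewrite det_combl rpredD // dvdz_mull.
have : (n %| p * det2 t z')%Z by rewrite dvdz_mull.
have -> : p * det2 t z' = p ^+ 2 * det2 z z' by rewrite /det2 e1 e2 q0; ring.
by move: pq; rewrite q0 expr0n mulr0 addr0 => ->; rewrite mul1r.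
Qed.

(** Bases with the same determinant differ by a rotation; when the determinants are opposite,
    conjugating the second basis makes them agree. *)
Lemma represents_unique_point n D B A z z' : 0 < n -> disc_form n D B A ->
  coprimez n (nrm z) -> coprimez n (nrm z') ->
  represents n D B A z -> represents n D B A z' ->
  (n %| det2 z z')%Z \/ (n %| det2 z (conj2 z'))%Z.
Proof.
move=> n0 d co co' [v [w [ev evw ew [vz wz]]]] r'.
have det := disc_det _ _ _ _ _ _ d ev evw ew.
have [v' [w' [ev' evw' ew' [vz' wz']]]] := r'.
have det' := disc_det _ _ _ _ _ _ d ev' evw' ew'.
have /eqP := det; rewrite -det' eqf_sqr => /orP[/eqP e|/eqP e].
  by left; apply: (unit_rotation v w v' w') => //; rewrite (ev, evw, ew).
right; apply: (unit_rotation v w (conj2 v') (conj2 w')); rewrite ?nrm_conj //.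
- by rewrite ev.
- by rewrite evw -evw' /dot /conj2 /=; ring.
- by rewrite ew.
- by rewrite e /det2 /conj2 /=; ring.
- have -> : det2 (conj2 v') (conj2 z') = - det2 v' z' by rewrite /det2 /=; ring.
  by rewrite rpredN.
- have -> : det2 (conj2 w') (conj2 z') = - det2 w' z' by rewrite /det2 /=; ring.
  by rewrite rpredN.
Qed.

Lemma coprime_primeW (m n : nat) : (0 < m)%N ->
  (forall p, prime p -> p %| m -> p %| n -> False)%N -> coprime m n.
Proof.
move=> m0 h; rewrite /coprime; apply: contraT => g1.
have pp : prime (pdiv (gcdn m n)).
  by apply: pdiv_prime; rewrite ltn_neqAle eq_sym g1 gcdn_gt0 m0.
have := pdiv_dvd (gcdn m n); rewrite dvdn_gcd => /andP[pm pn].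
by case: (h _ pp pm pn).
Qed.

Lemma dvdn_part_prime (pi : nat_pred) (n p : nat) : prime p -> (0 < n)%N -> (p %| n)%N ->
  (p %| n`_pi)%N = (p \in pi).
Proof.
move=> pp n0 pn; have := pi_of_part pi n0 p.
by rewrite !inE !mem_primes pp part_gt0 n0 pn.
Qed.

(* X is divisible by the primes dividing D but not A, and Y by those not dividing D;
   for every prime p | n exactly one term of the form is then prime to p. *)
Lemma coprime_value (n : nat) D B A : (0 < n)%N -> ~~ (2 %| D)%Z ->
  gcdz D (gcdz B A) == 1 ->
  exists X Y : int, coprimez n (qformD D B A X Y) /\ coprimez X (2 * Y).
Proof.
move=> n0 oD /(prim_primeP _ _ _ oD) prim.
pose piX : nat_pred := [pred p : nat | (p %| D)%Z && ~~ (p %| A)%Z].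
pose piY : nat_pred := [pred p : nat | ~~ (p %| D)%Z].
pose X := (n`_piX)%N; pose Y := (n`_piY)%N.
exists X, Y; split; last first.
  rewrite coprimezE abszM /=; apply: coprime_primeW; first exact: part_gt0.
  move=> p pp pX; have pn := dvdn_trans pX (dvdn_part _ _).
  move: pX; rewrite dvdn_part_prime // inE => /andP[pD _].
  rewrite Euclid_dvdM // [X in _ || X]dvdn_part_prime // inE pD orbF.
  by rewrite dvdn_prime2 // => /eqP p2; rewrite p2 in pD; case/negP: oD.
rewrite coprimezE /=; apply: coprime_primeW => // p pp pn.
rewrite -[X in (X %| _)%N]/(absz p%:Z) -dvdzE => pf.
have EuM (a b : int) : (p%:Z %| a * b)%Z = (p%:Z %| a)%Z || (p%:Z %| b)%Z.
  by rewrite !dvdzE abszM Euclid_dvdM.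
have EuX (a : int) : (p%:Z %| a ^+ 2)%Z = (p%:Z %| a)%Z.
  by rewrite !dvdzE abszX Euclid_dvdX // andbT.
have pX : (p%:Z %| X%:Z)%Z = (p %| D)%Z && ~~ (p %| A)%Z.
  by rewrite dvdzE dvdn_part_prime.
have pY : (p%:Z %| Y%:Z)%Z = ~~ (p %| D)%Z by rewrite dvdzE dvdn_part_prime.
have p2 : (p %| D)%Z -> (p%:Z %| 2)%Z = false.
  move=> pD; apply/negP; rewrite dvdzE dvdn_prime2 // => /eqP /= p2.
  by rewrite p2 in pD; case/negP: oD.
have [pD|pD] := boolP (p %| D)%Z; last first.
  have : (p%:Z %| D * X%:Z ^+ 2)%Z.
    have -> : D * X%:Z ^+ 2 = qformD D B A X Y - (2 * B * X + 4 * A * Y) * Y.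
      by rewrite /qformD; ring.
    by rewrite rpredB // dvdz_mull // pY.
  by rewrite EuM EuX pX (negbTE pD).
have [pA|pA] := boolP (p %| A)%Z; last first.
  have : (p%:Z %| 2 * 2 * A * Y%:Z ^+ 2)%Z.
    have -> : 2 * 2 * A * Y%:Z ^+ 2 = qformD D B A X Y - (D * X + 2 * B * Y) * X.
      by rewrite /qformD; ring.
    by rewrite rpredB // dvdz_mull // pX pD pA.
  by rewrite !EuM pY pD (negbTE pA) p2.
have : (p%:Z %| 2 * B * X%:Z * Y%:Z)%Z.
  have -> : 2 * B * X%:Z * Y%:Z = qformD D B A X Y - X%:Z ^+ 2 * D - 4 * Y%:Z ^+ 2 * A.
    by rewrite /qformD; ring.
  by rewrite !rpredB // dvdz_mull.
by rewrite !EuM pX pY pD pA p2 //= !orbF => pB; exact: (prim p).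
Qed.

(** This is class number one: a reduced triple has B^2 <= 2AD, so 4AD = B^2 + 3 leaves only AD <=
    1. *)
Lemma reduced_disc3 D B A : 0 < D -> 0 < A -> 4 * A * D = B ^+ 2 + 3 ->
  reduced_form D B A -> [/\ D = 1, B = 1 & A = 1].
Proof.
move=> D0 A0 disc /and3P[B0 BD BA].
have AD : A * D <= 1.
  have : B * B <= D * (2 * A) by apply: ler_pM.
  by move: disc; rewrite expr2 -mulrA [D * _]mulrC -mulrA; move: (A * D) (B * B); clear; lia.
have eA : A = 1.
  apply/eqP; rewrite eq_le -gtz0_ge1 A0 andbT; apply: le_trans AD.
  by rewrite ler_peMr -?gtz0_ge1 // ltW.
have eD : D = 1 by move: AD; rewrite eA mul1r; clear -D0; lia.
by subst; split=> //; lia.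
Qed.

(** Reduction leads to (1, 1, 1), which is the norm form in the basis (1, 0), (1, 1); the inverse
    base change is applied to that basis. *)
Lemma represents_disc1 D B A : 0 < D -> 0 < A -> 4 * A * D = B ^+ 2 + 3 ->
  exists v w, [/\ nrm v = D, dot v w = B, nrm w = 4 * A & det2 v w ^+ 2 = 1].
Proof.
move=> D0 A0 disc.
have [||//|X [Y [Z [T [u r]]]]] := reduce_form D B A; rewrite ?disc ?ltrDl //.
have [eD eB eA] := form_inverse D B A _ _ _ _ u.
set D' := qformD _ _ _ _ _ in r eD eB eA; set B' := qformB _ _ _ _ _ _ _ in r eD eB eA.
set A' := qformA _ _ _ _ _ in r eD eB eA.
have disc' : 4 * A' * D' = B' ^+ 2 + 3.
  transitivity (B' ^+ 2 + (4 * A * D - B ^+ 2) * (X * T - 2 * Y * Z) ^+ 2).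
    by rewrite /A' /B' /D' /qformA /qformB /qformD; ring.
  by rewrite u disc; ring.
have r' := r; case/and3P: r' => B'0 B'D _.
have D'0 : 0 < D'.
  have D'0 := le_trans B'0 B'D; rewrite lt_neqAle D'0 andbT.
  by apply: contra_eq_neq disc' => <-; rewrite mulr0 lt_eqF // ltr_wpDl ?sqr_ge0.
have A'0 : 0 < A'.
  have : 0 < 4 * A' * D' by rewrite disc' ltr_wpDl ?sqr_ge0.
  by rewrite pmulr_lgt0 // pmulr_rgt0.
have [e1 e2 e3] := reduced_disc3 _ _ _ D'0 A'0 disc' r.
exists (comb T (1, 0) (- Y) (1, 1)), (comb (- 2 * Z) (1, 0) X (1, 1)).
rewrite !nrm_comb dot_comb det_comb; split.
- by rewrite eD e1 e2 e3 /qformD /nrm /dot /=; ring.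
- by rewrite [RHS]eB e1 e2 e3 /qformB /nrm /dot /=; ring.
- by rewrite [in RHS]eA e1 e2 e3 /qformA /nrm /dot /=; ring.
- by rewrite -[RHS]u /det2 /=; ring.
Qed.

Lemma disc_parity n D B A : 4 * A * D = B ^+ 2 + 3 * n ^+ 2 -> (2 %| B - n)%Z.
Proof.
move=> disc; have : (2 %| (B - n) ^+ 2)%Z.
  apply/dvdzP; exists (2 * A * D - n ^+ 2 - B * n).
  transitivity (4 * A * D - 2 * n ^+ 2 - 2 * B * n); last by ring.
  by rewrite disc; ring.
by rewrite !dvdzE abszX Euclid_dvdX // => /andP[].
Qed.

(** The form is brought to the shape (D1, n b, n^2 a) with D1 prime to n. This is the form (D1, b,
    a), with 4 a D1 = b^2 + 3, after its second basis vector has been multiplied by n. A basis v0,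
    w0 for (D1, b, a) exists, and v0 is the required point: v0 and n w0 are proportional to it
    modulo n. *)
Lemma represents_point (n : nat) D B A : (0 < n)%N -> 0 < D -> disc_form n D B A ->
  exists z, coprimez n (nrm z) /\ represents n D B A z.
Proof.
move=> n0 D0 d; have /and3P[/eqP disc oD prim] := d.
have [X [Y [cof coX]]] := coprime_value _ _ _ _ n0 oD prim.
have [T [Z' u1]] := Bezoutz X (2 * Y).
have {Z' u1}[Z u1] : exists Z, X * T - 2 * Y * Z = 1.
  by exists (- Z'); rewrite -[RHS](eqP coX) -u1; ring.
have u : (X * T - 2 * Y * Z) ^+ 2 = 1 by rewrite u1 expr1n.
have [eD eB eA] := form_inverse D B A _ _ _ _ u.
set D1 := qformD _ _ _ _ _ in cof eD eB eA.
set B1 := qformB _ _ _ _ _ _ _ in eD eB eA.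
set A1 := qformA _ _ _ _ _ in eD eB eA.
have disc1 : 4 * A1 * D1 = B1 ^+ 2 + 3 * n%:Z ^+ 2.
  transitivity (B1 ^+ 2 + (4 * A * D - B ^+ 2) * (X * T - 2 * Y * Z) ^+ 2).
    by rewrite /A1 /B1 /D1 /qformA /qformB /qformD; ring.
  by rewrite u disc; ring.
have n0' : 0 < n%:Z by [].
have D10 : 0 < D1.
  have : 0 < 4 * D * D1.
    have -> : 4 * D * D1 = (2 * D * X + 2 * B * Y) ^+ 2 + 4 * (4 * A * D - B ^+ 2) * Y ^+ 2.
      by rewrite /D1 /qformD; ring.
    have [Y0|Y0] := eqVneq Y 0.
      rewrite Y0 expr0n /= !mulr0 !addr0 exprn_even_gt0 //= !mulf_neq0 //.
        by rewrite gt_eqF.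
      by have /andP[] := unimodular_neq0 _ _ _ _ u.
    have Y2 : 0 < Y ^+ 2 by rewrite exprn_even_gt0.
    have h : 0 < 4 * A * D - B ^+ 2.
      by rewrite disc [B ^+ 2 + _]addrC addrK pmulr_rgt0 // exprn_gt0.
    by rewrite ltr_wpDl ?sqr_ge0 // pmulr_lgt0 // pmulr_rgt0.
  by rewrite pmulr_rgt0 // mulr_gt0.
have par := disc_parity _ _ _ _ disc1.
have [be ebe] := dvdzP par.
have [e [f ef]] := Bezoutz n D1.
rewrite (eqP cof) in ef.
(* f inverts D1 modulo n, and B1 - n = 2 be, so this k makes B1 + 2 D1 k a multiple of n. The
   cofactor b is odd, hence b^2 + 3 is 4 c. *)
pose k := - be * f; pose b := 1 + 2 * be * e.
have eb : B1 + 2 * D1 * k = n%:Z * b.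
  have -> : B1 = n%:Z * (e * n%:Z + f * D1) + be * 2 * (e * n%:Z + f * D1) - n%:Z * (e * n%:Z + f * D1) + n%:Z.
    by rewrite ef -ebe; ring.
  rewrite /k /b; ring.
pose c := 1 + be * e + be ^+ 2 * e ^+ 2.
have bc : b ^+ 2 + 3 = 4 * c by rewrite /b /c; ring.
pose A2 := D1 * k ^+ 2 + B1 * k + A1.
have eA2 : A2 * D1 = n%:Z ^+ 2 * c.
  apply: (mulfI (_ : 4 != 0)) => //.
  transitivity ((B1 + 2 * D1 * k) ^+ 2 + (4 * A1 * D1 - B1 ^+ 2)).
    by rewrite /A2; ring.
  by rewrite eb disc1 [RHS]mulrCA -bc; ring.
have : (D1 %| c)%Z.
  rewrite -(@Gauss_dvdzr _ (n%:Z ^+ 2)); last by rewrite coprimezXr // coprimez_sym.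
  by rewrite -eA2 dvdz_mull.
case/dvdzP=> a ea.
have {}eA2 : A2 = n%:Z ^+ 2 * a.
  by apply: (mulIf (lt0r_neq0 D10)); rewrite eA2 ea mulrA.
have c0 : 0 < c.
  have : 0 < 4 * c by rewrite -bc ltr_wpDl ?sqr_ge0.
  by rewrite pmulr_rgt0.
have a0 : 0 < a by move: c0; rewrite ea pmulr_lgt0.
have [|v0 [w0 [ev evw ew _]]] := represents_disc1 D1 b a D10 a0.
  by rewrite bc ea; ring.
(* Subtracting 2k v0 from n w0 undoes the shear that made the middle coefficient divisible by n. *)
pose w1 := comb (- 2 * k) v0 n w0.
have ew1 : nrm w1 = 4 * A1.
  rewrite nrm_comb ev evw ew.
  transitivity (4 * (n%:Z ^+ 2 * a) + 4 * D1 * k ^+ 2 - 4 * k * (n%:Z * b)); first by ring.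
  by rewrite -eA2 -eb /A2; ring.
have evw1 : dot v0 w1 = B1.
  transitivity (n%:Z * b - 2 * D1 * k); last by rewrite -eb; ring.
  by rewrite -evw -ev /dot /nrm /w1 /comb /=; ring.
exists v0; rewrite ev; split=> //.
have vv : (n %| det2 v0 v0)%Z by rewrite /det2 mulrC subrr.
have wv : (n %| det2 w1 v0)%Z.
  have -> : det2 w1 v0 = det2 w0 v0 * n%:Z by rewrite /det2 /w1 /comb /=; ring.
  exact: dvdz_mull.
clearbody w1; exists (comb T v0 (- Y) w1), (comb (- 2 * Z) v0 X w1).
rewrite !nrm_comb dot_comb !det_combl ev evw1 ew1; split.
- by rewrite [RHS]eD /qformD; ring.
- by rewrite [RHS]eB /qformB; ring.
- by rewrite [in RHS]eA /qformA; ring.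
by split; rewrite rpredD // dvdz_mull.
Qed.

End LatticesB.

(** * Triples and points modulo n *)

Lemma coprimez_congr (n a b : int) : (n %| a - b)%Z -> coprimez n a = coprimez n b.
Proof.
case/dvdzP=> q e; have -> : a = q * n + b by rewrite -e subrK.
by rewrite /coprimez gcdzMDl.
Qed.

Lemma line_scalar (n : int) (z u : int * int) :
  coprimez n (nrm z) -> coprimez n (nrm u) -> (n %| det2 z u)%Z ->
  exists k, [/\ coprimez n k, (n %| k * z.1 - u.1)%Z & (n %| k * z.2 - u.2)%Z].
Proof.
move=> co cou /dvdzP[q eq].
have [d [c cd]] := Bezoutz n (nrm z); rewrite (eqP co) in cd.
have e1 : c * nrm z = 1 - d * n by rewrite -cd; ring.
(* The conjugate of z times u is [dot z u] modulo n, because [det2 z u] vanishes there; multiplying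
   by z and by the inverse c of [nrm z] expresses u as a multiple of z. *)
exists (c * dot z u); split.
- rewrite coprimezMr; apply/andP; split.
    have : coprimez n (c * nrm z).
      rewrite (coprimez_congr _ _ 1) ?/coprimez ?gcdz1 // e1.
      by apply/dvdzP; exists (- d); ring.
    by rewrite coprimezMr => /andP[].
  rewrite -(@coprimez_pexpr 2) // (coprimez_congr _ _ (nrm z * nrm u)).
    by rewrite coprimezMr co cou.
  rewrite nrm_mul eq; apply/dvdzP; exists (- (3 * q ^+ 2 * n)); ring.
- have -> : c * dot z u * z.1 - u.1 = c * nrm z * u.1 + 3 * c * z.2 * det2 z u - u.1.
    by rewrite /dot /nrm /det2; ring.
  by rewrite e1 eq; apply/dvdzP; exists (3 * c * z.2 * q - d * u.1); ring.
- have -> : c * dot z u * z.2 - u.2 = c * nrm z * u.2 - c * z.1 * det2 z u - u.2.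
    by rewrite /dot /nrm /det2; ring.
  by rewrite e1 eq; apply/dvdzP; exists (- c * z.1 * q - d * u.2); ring.
Qed.

Section Counting.
Variable m : nat.
Let n := m.+1.
Local Notation point := ('I_n * 'I_n)%type.
Implicit Types (z : int * int) (u : point).

Definition residue (a : int) : 'I_n := inord (absz (a %% n)%Z).
Definition lift2 (u : point) : int * int := ((u.1 : nat)%:Z, (u.2 : nat)%:Z).

Lemma residueE a : (residue a : nat)%:Z = (a %% n)%Z.
Proof.
have h : 0 <= (a %% n)%Z by rewrite modz_ge0.
rewrite /residue inordK ?gez0_abs //.
by rewrite -ltz_nat gez0_abs // ltz_pmod.
Qed.

Lemma ord_dvd_inj (i j : 'I_n) : (n %| (i : nat)%:Z - (j : nat)%:Z)%Z -> i = j.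
Proof.
rewrite -eqz_mod_dvd !modz_small ?ltz_nat ?ltn_ord //.
by move/eqP => [] /val_inj.
Qed.

Lemma eq_residue a (i : 'I_n) : (n %| a - (i : nat)%:Z)%Z -> residue a = i.
Proof.
move=> h; apply: ord_dvd_inj; rewrite residueE -eqz_mod_dvd modz_mod.
by rewrite eqz_mod_dvd.
Qed.

Definition unit_points := [pred u : point | coprimez n (nrm (lift2 u))].
(** Modulo n and up to scalars, conjugation is inversion, since z times its conjugate is a scalar.
    The points proportional to their conjugate are therefore those whose square is a scalar, and the
    sqrt(-3)-coordinate of that square is 2xy. *)
Definition two_torsion_points :=
  [pred u : point | (u \in unit_points) && (n %| 2 * (u.1 * u.2))%N].
Definition line z := [pred u : point | (u \in unit_points) && (n %| det2 z (lift2 u))%Z].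

Lemma card_coprime_ord : #|[pred i : 'I_n | coprime n i]| = totient n.
Proof.
rewrite totient_count_coprime big_mkord -sum1_card big_mkcond /=.
by apply: eq_bigr => i _; rewrite inE; case: coprime.
Qed.

Lemma card_line z : coprimez n (nrm z) -> #|line z| = totient n.
Proof.
move=> co; rewrite -card_coprime_ord.
pose f (l : 'I_n) : point := (residue ((l : nat)%:Z * z.1), residue ((l : nat)%:Z * z.2)).
have fE (l : 'I_n) : exists a b : int,
    lift2 (f l) = ((l : nat)%:Z * z.1 + a * n%:Z, (l : nat)%:Z * z.2 + b * n%:Z).
  exists (- ((l : nat)%:Z * z.1 %/ n)%Z), (- ((l : nat)%:Z * z.2 %/ n)%Z).
  by rewrite /lift2 /f /= !residueE /modz !mulNr.
rewrite -(@card_in_image _ _ f [pred i : 'I_n | coprime n i]) => [|i j _ _ e].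
  apply: eq_card => u; apply/idP/fintype.imageP => [/andP[cou d]|[l col ->]].
    have [k [cok k1 k2]] := line_scalar _ _ _ co cou d.
    have kr : (n %| (residue k : nat)%:Z - k)%Z by rewrite residueE -eqz_mod_dvd modz_mod.
    exists (residue k).
      have := coprimez_congr _ _ _ kr; rewrite cok inE coprimezE /= => ->.
      by [].
    rewrite [u]surjective_pairing /f; congr pair; apply/esym/eq_residue.
      have -> : (residue k : nat)%:Z * z.1 - (u.1 : nat)%:Z =
        ((residue k : nat)%:Z - k) * z.1 + (k * z.1 - (lift2 u).1) by rewrite /lift2 /=; ring.
      by rewrite rpredD // dvdz_mulr.
    have -> : (residue k : nat)%:Z * z.2 - (u.2 : nat)%:Z =
      ((residue k : nat)%:Z - k) * z.2 + (k * z.2 - (lift2 u).2) by rewrite /lift2 /=; ring.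
    by rewrite rpredD // dvdz_mulr.
  have [a [b e]] := fE l; rewrite !inE e /nrm /det2 /=; apply/andP; split.
    rewrite (coprimez_congr _ _ ((l : nat)%:Z ^+ 2 * nrm z)).
      by rewrite coprimezMr coprimezXr.
    apply/dvdzP; exists (a * (2 * (l : nat)%:Z * z.1 + a * n%:Z)
       + 3 * b * (2 * (l : nat)%:Z * z.2 + b * n%:Z)); rewrite /nrm; ring.
  by apply/dvdzP; exists (z.1 * b - z.2 * a); ring.
have [a [b ei]] := fE i; have [c [d ej]] := fE j.
move: ei; rewrite e ej => -[e1 e2].
apply: ord_dvd_inj; rewrite -(@Gauss_dvdzl _ _ (nrm z)) //.
apply/dvdzP; exists (z.1 * (c - a) + 3 * z.2 * (d - b)).
have h1 : ((i : nat)%:Z - (j : nat)%:Z) * z.1 = (c - a) * n%:Z by move: e1; clear; lia.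
have h2 : ((i : nat)%:Z - (j : nat)%:Z) * z.2 = (d - b) * n%:Z by move: e2; clear; lia.
transitivity (((i : nat)%:Z - (j : nat)%:Z) * z.1 * z.1 +
   3 * z.2 * (((i : nat)%:Z - (j : nat)%:Z) * z.2)); first by rewrite /nrm; ring.
by rewrite h1 h2; ring.
Qed.

(** Reducedness gives B^2 <= 2AD, hence 2AD <= 3n^2; all entries of a root form are below K, which
    makes the set of root forms finite. *)
Let K := (3 * n ^ 2).+1.
Local Notation triple := ('I_K * 'I_K * 'I_K)%type.
Definition root_form (D B A : int) := disc_form n D B A && reduced_form D B A.
Definition root_forms := [pred t : triple |
   root_form (t.1.1 : nat)%:Z (t.1.2 : nat)%:Z (t.2 : nat)%:Z].

Lemma root_form_pos (D B A : int) : root_form D B A -> [/\ 0 < D, 0 <= B & 0 < A].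
Proof.
case/andP=> d /and3P[B0 BD _].
by have [] := disc_form_pos n _ _ _ isT d (le_trans B0 BD).
Qed.

Lemma root_form_bound (D B A : int) : root_form D B A ->
  exists t : triple, [/\ D = (t.1.1 : nat)%:Z, B = (t.1.2 : nat)%:Z & A = (t.2 : nat)%:Z].
Proof.
move=> r; have [D0 B0 A0] := root_form_pos _ _ _ r.
have /andP[/and3P[/eqP disc _ _] /and3P[_ BD BA]] := r.
have AD : 2 * (A * D) <= 3 * n%:Z ^+ 2.
  have : B * B <= D * (2 * A) by apply: ler_pM.
  move: disc; rewrite expr2 -mulrA [D * _]mulrC -mulrA.
  by move: (A * D) (B * B) (n%:Z ^+ 2); clear; lia.
have Dle : D <= A * D by rewrite ler_peMl -?gtz0_ge1 // ltW.
have Ale : A <= A * D by rewrite ler_peMr -?gtz0_ge1 // ltW.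
have eK : K%:Z = 3 * n%:Z ^+ 2 + 1 by rewrite /K -addn1 PoszD PoszM expnS expn1 PoszM.
have P0 : 0 < A * D by rewrite mulr_gt0.
have hD : (absz D < K)%N by rewrite -ltz_nat eK gez0_abs ?ltW //; move: AD Dle P0; clear; lia.
have hA : (absz A < K)%N by rewrite -ltz_nat eK gez0_abs ?ltW //; move: AD Ale P0; clear; lia.
have hB : (absz B < K)%N by apply: leq_ltn_trans hD; move: B0 BD; clear; lia.
exists (Ordinal hD, Ordinal hB, Ordinal hA); split; rewrite /= gez0_abs //; exact: ltW.
Qed.

(** Points are sorted by the triple that represents them. For one triple the unit points are the
    union of [line z] and [line (conj2 z)], and the two-torsion points are the intersection, so the
    two counts add up to 2 phi(n) whether or not the lines coincide. *)
Lemma card_root_forms :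
  (#|unit_points| + #|two_torsion_points| = 2 * totient n * #|root_forms|)%N.
Proof.
pose rep (t : triple) u := `[< represents n (t.1.1 : nat)%:Z (t.1.2 : nat)%:Z (t.2 : nat)%:Z (lift2 u) >].
have uniq u : u \in unit_points -> #|[pred t in root_forms | rep t u]| = 1%N.
  move=> cou; have [D [B [A [d r h]]]] := represents_ex n _ isT cou.
  have [|t [eD eB eA]] := root_form_bound D B A; first by rewrite /root_form d.
  rewrite eD eB eA in d r h.
  apply: (@fintype.eq_card1 _ t) => s; apply/andP/eqP => [[/andP[ds rs] /asboolP hs]|->].
    have [e1 e2 e3] := represents_uniq n _ _ _ _ _ _ _ isT cou d r h ds rs hs.
    by rewrite [s]surjective_pairing [s.1]surjective_pairing
       [t]surjective_pairing [t.1]surjective_pairing;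
     congr (_, _, _); apply: val_inj; case: e1 e2 e3 => ? [?] [?].
  by split; [rewrite inE /root_form d|apply/asboolP].
have cardE (P : pred point) : {subset P <= unit_points} ->
    #|P| = (\sum_(t in root_forms) #|[pred u in P | rep t u]|)%N.
  move=> sP; rewrite -sum1_card.
  transitivity (\sum_(u in P) \sum_(t in root_forms | rep t u) 1)%N.
    by apply: eq_bigr => u /sP/uniq e; rewrite -[LHS]e -sum1_card; apply: eq_bigl.
  rewrite (exchange_big_dep (mem root_forms)) /= => [|u t _ /andP[]//].
  apply: eq_bigr => t rt; rewrite -sum1_card; apply: eq_bigl => u.
  by rewrite !inE; move: rt; rewrite inE => ->.
rewrite (cardE unit_points) // (cardE two_torsion_points); last by move=> u /andP[].
rewrite -big_split /= -sum1_card big_distrr /=; apply: eq_bigr => t rt.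
have /andP[d r] := rt.
have [D0 _ _] := root_form_pos _ _ _ rt.
have [z [co h]] := represents_point n _ _ _ isT D0 d.
have co' : coprimez n (nrm (conj2 z)) by rewrite nrm_conj.
rewrite muln1 mul2n -addnn.
transitivity (#|line z| + #|line (conj2 z)|)%N; last by rewrite !card_line.
have dconj (u v : int * int) : det2 (conj2 u) (conj2 v) = - det2 u v by rewrite /det2 /=; ring.
have conjK (u : int * int) : conj2 (conj2 u) = u by rewrite /conj2 /= opprK -surjective_pairing.
apply: etrans (cardUI _ _); congr addn; apply: eq_card => u; rewrite !inE.
  apply/andP/orP => [[cou /asboolP hu]|].
    have [e|e] := represents_unique_point n _ _ _ _ _ isT d co cou h hu.
      by left; apply/andP.
    right; apply/andP; split=> //.
    by rewrite -[lift2 u]conjK dconj rpredN.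
  case=> /andP[cou e]; split=> //; apply/asboolP.
    exact: represents_congr e h.
  exact: represents_congr e (represents_conj _ _ _ _ _ h).
have dd : det2 (conj2 (lift2 u)) (lift2 u) = (2 * (u.1 * u.2))%N.
  by rewrite /det2 /= !PoszM; ring.
apply/andP/andP => [[/andP[cou n2] /asboolP hu]|[/andP[cou e] /andP[_ e']]]; last first.
  rewrite cou /=; split; last by apply/asboolP; exact: represents_congr e h.
  rewrite -[(_ %| _)%N]/(n%:Z %| (2 * (u.1 * u.2))%N%:Z)%Z -dd.
  apply: (det_dvd _ _ _ (conj2 z)) => //; last by rewrite det2C rpredN.
  by rewrite dconj rpredN det2C rpredN.
have {}n2 : (n %| det2 (conj2 (lift2 u)) (lift2 u))%Z by rewrite dd.
suff: (n %| det2 z (lift2 u))%Z /\ (n %| det2 (conj2 z) (lift2 u))%Z.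
  by case=> -> ->; rewrite cou.
have couc : coprimez n (nrm (conj2 (lift2 u))) by rewrite nrm_conj.
have [e|e] := represents_unique_point n _ _ _ _ _ isT d co cou h hu; split=> //.
- apply: (det_dvd _ _ _ (conj2 (lift2 u))) => //; first by rewrite dconj rpredN.
  by rewrite det2C rpredN.
- apply: (det_dvd _ _ _ (conj2 (lift2 u))) => //.
  by rewrite det2C rpredN.
- by rewrite -[lift2 u]conjK dconj rpredN.
Qed.

End Counting.

(** * Multiplicative counts *)

Section PairCount.
Local Open Scope nat_scope.

Definition pair_count (P : nat -> nat -> nat -> bool) (n : nat) :=
  \sum_(x < n) \sum_(y < n) P n x y.

Definition unit_pair n x y := coprime n (x ^ 2 + 3 * y ^ 2).
Definition torsion_pair n x y := unit_pair n x y && (n %| 2 * (x * y)).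

Lemma sum_crt m n (F : nat -> nat -> nat) : 0 < m -> 0 < n -> coprime m n ->
  \sum_(x < m * n) F (x %% m) (x %% n) = \sum_(a < m) \sum_(b < n) F a b.
Proof.
move=> m0 n0 co; rewrite pair_bigA /=.
pose h (x : 'I_(m * n)) : 'I_m * 'I_n :=
  (Ordinal (ltn_pmod x m0), Ordinal (ltn_pmod x n0)).
have hinj : injective h.
  move=> x y [e1 e2]; apply: val_inj => /=.
  have /eqP : x = y %[mod m * n].
    by apply/eqP; rewrite chinese_remainder // e1 e2 !eqxx.
  by rewrite !modn_small ?ltn_ord // => /eqP.
rewrite (reindex h) //=.
by apply/onW_bij/inj_card_bij => //; rewrite card_prod !card_ord.
Qed.

Lemma pair_count_mul P m n : 0 < m -> 0 < n -> coprime m n ->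
  (forall x y, P (m * n) x y = P m (x %% m) (y %% m) && P n (x %% n) (y %% n)) ->
  pair_count P (m * n) = pair_count P m * pair_count P n.
Proof.
move=> m0 n0 co hP; rewrite /pair_count.
under eq_bigr => x _ do under eq_bigr => y _ do rewrite hP -mulnb.
under eq_bigr => x _ do
  rewrite (sum_crt _ _ (fun a b => P m (x %% m) a * P n (x %% n) b)) //.
rewrite (sum_crt _ _ (fun a b => \sum_(c < m) \sum_(d < n) P m a c * P n b d)) //.
rewrite big_distrl /=; apply: eq_bigr => a _.
rewrite big_distrr /=; apply: eq_bigr => b _.
rewrite big_distrl /=; apply: eq_bigr => c _.
by rewrite big_distrr.
Qed.

Lemma coprime_eqmod n k v w : n %| k -> v = w %[mod k] -> coprime n v = coprime n w.
Proof. by move=> nk e; rewrite -(coprime_modr n v) -(coprime_modr n w) -(modn_dvdm v nk) e modn_dvdm. Qed.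

Lemma modn_nrm k x y : (x %% k) ^ 2 + 3 * (y %% k) ^ 2 = x ^ 2 + 3 * y ^ 2 %[mod k].
Proof. by rewrite -modnDm modnXm -(modnMmr 3) modnXm modnMmr modnDm. Qed.

Lemma unit_pair_mod n k x y : n %| k ->
  unit_pair n (x %% k) (y %% k) = unit_pair n x y.
Proof. by move=> nk; apply: coprime_eqmod nk _; exact: modn_nrm. Qed.

Lemma unit_pair_mul m n x y : unit_pair (m * n) x y =
  unit_pair m (x %% m) (y %% m) && unit_pair n (x %% n) (y %% n).
Proof. by rewrite !unit_pair_mod // /unit_pair coprimeMl. Qed.

Lemma torsion_pair_mul m n x y : coprime m n -> torsion_pair (m * n) x y =
  torsion_pair m (x %% m) (y %% m) && torsion_pair n (x %% n) (y %% n).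
Proof.
move=> co; rewrite /torsion_pair unit_pair_mul Gauss_dvd //.
have e k : (k %| 2 * ((x %% k) * (y %% k))) = (k %| 2 * (x * y)).
  by rewrite /dvdn -(modnMmr 2) modnMm modnMmr.
by rewrite !e andbACA.
Qed.

Lemma sum_periodic m k (F : nat -> nat) : 
  \sum_(x < m * k) F (x %% m) = k * \sum_(a < m) F a.
Proof.
elim: k => [|k IH]; first by rewrite muln0 big_ord0.
rewrite mulnS addnC big_split_ord /= IH mulSn addnC; congr (_ + _).
by apply: eq_bigr => i _; rewrite [m * k]mulnC modnMDl modn_small.
Qed.

(** Being prime to p is visible modulo p, and each residue modulo p has p^e lifts in each
    coordinate. *)
Lemma unit_count_pfactor p e : prime p ->
  pair_count unit_pair (p ^ e.+1) = (p ^ e) ^ 2 * pair_count unit_pair p.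
Proof.
move=> pp; rewrite /pair_count expnS.
have h x y : unit_pair (p * p ^ e) x y = unit_pair p (x %% p) (y %% p).
  by rewrite unit_pair_mod // -expnS /unit_pair coprime_pexpl.
under eq_bigr => x _ do under eq_bigr => y _ do rewrite h.
under eq_bigr => x _ do rewrite (sum_periodic _ _ (fun y => unit_pair p (x %% p) y)).
rewrite (sum_periodic _ _ (fun x => p ^ e * \sum_(a < p) unit_pair p x a)).
by rewrite -big_distrr mulnA.
Qed.

Lemma sum_coprime n : \sum_(x < n) coprime n x = totient n.
Proof. by rewrite totient_count_coprime big_mkord. Qed.

Lemma sum_coprime_pfactor p e : prime p -> 
  \sum_(x < p ^ e.+1) coprime p x = totient (p ^ e.+1).
Proof.
by move=> pp; rewrite -sum_coprime; apply: eq_bigr => x _; rewrite coprime_pexpl.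
Qed.

Lemma sum_eq0 n : 0 < n -> \sum_(x < n) (x == 0 :> nat) = 1.
Proof.
by case: n => // n _; rewrite big_ord_recl /= big1 ?addn0.
Qed.

Lemma sum_dvd h : 0 < h -> \sum_(x < h * 2) (h %| x) = 2.
Proof.
move=> h0; transitivity (2 * \sum_(x < h) (x == 0 :> nat)); last by rewrite sum_eq0.
by rewrite -(sum_periodic h 2 (fun x => x == 0 :> nat)).
Qed.

Lemma sum_mul n (F G : nat -> nat) :
  \sum_(x < n) \sum_(y < n) F x * G y = (\sum_(x < n) F x) * (\sum_(y < n) G y).
Proof. by rewrite big_distrl /=; apply: eq_bigr => x _; rewrite big_distrr. Qed.

(** If p divides both coordinates the norm is not a unit, and if it divides neither it cannot divide
    2xy. Otherwise the full prime power divides one coordinate, which is smaller and thus 0. *)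
Lemma torsion_pair_p p e x y : prime p -> 3 < p -> x < p ^ e.+1 -> y < p ^ e.+1 ->
  torsion_pair (p ^ e.+1) x y =
  (x == 0) * coprime p y + coprime p x * (y == 0) :> nat.
Proof.
move=> pp p3 xn yn; rewrite /torsion_pair /unit_pair coprime_pexpl //.
have co2 : coprime (p ^ e.+1) 2.
  by rewrite coprime_pexpl // prime_coprime // dvdn_prime2 //; lia.
have co3 : coprime p 3 by rewrite prime_coprime // dvdn_prime2 //; lia.
rewrite Gauss_dvdr // !prime_coprime //.
have zx z : z < p ^ e.+1 -> p ^ e.+1 %| z -> z = 0.
  by case: z => // z zn /dvdn_leq => /(_ isT); rewrite leqNgt zn.
have d3 : (p %| 3 * y ^ 2) = (p %| y).
  by rewrite Gauss_dvdr ?Euclid_dvdX ?andbT // coprime_sym coprime_sym.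
have dx : (p %| x ^ 2) = (p %| x) by rewrite Euclid_dvdX ?andbT.
have [px|px] := boolP (p %| x); have [py|py] := boolP (p %| y).
- by rewrite dvdn_addr ?dx // d3 py /= !muln0.
- rewrite dvdn_addr ?dx // d3 (negbTE py) /=.
  rewrite mul0n addn0 muln1 Gauss_dvdl; last by rewrite coprime_pexpl // prime_coprime.
  by congr nat_of_bool; apply/idP/eqP => [/zx -> //|->].
- rewrite dvdn_addl ?d3 // dx (negbTE px) /=.
  rewrite muln0 add0n mul1n Gauss_dvdr; last by rewrite coprime_pexpl // prime_coprime.
  by congr nat_of_bool; apply/idP/eqP => [/zx -> //|->].
- have -> : (x == 0) = false by apply: contraNF px => /eqP->.
  have -> : (y == 0) = false by apply: contraNF py => /eqP->.
  rewrite /= Gauss_dvdl; last by rewrite coprime_pexpl // prime_coprime.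
  rewrite (_ : p ^ e.+1 %| x = false) ?andbF //; apply: contraNF px.
  by apply: dvdn_trans; rewrite dvdn_exp.
Qed.

Lemma torsion_count_p p e : prime p -> 3 < p ->
  pair_count torsion_pair (p ^ e.+1) = 2 * totient (p ^ e.+1).
Proof.
move=> pp p3; rewrite /pair_count.
have n0 : 0 < p ^ e.+1 by rewrite expn_gt0 prime_gt0.
under eq_bigr => x _ do (under eq_bigr => y _ do rewrite torsion_pair_p //); rewrite ?big_split /=.
under eq_bigr => x _ do rewrite big_split.
rewrite big_split /= (sum_mul _ (fun x => x == 0 :> nat) (fun y => coprime p y)).
rewrite (sum_mul _ (fun y => coprime p y) (fun x => x == 0 :> nat)).
by rewrite !sum_coprime_pfactor // !sum_eq0 // mul1n muln1 mul2n addnn.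
Qed.

(** The norm is x^2 modulo 3, so a unit has x prime to 3 and y must vanish. The case x = 0
    disappears, and 3 contributes no factor 2; this is why the exponent involves [omega (3 * n)], to
    which 3 always contributes one. *)
Lemma torsion_count_3 e : pair_count torsion_pair (3 ^ e.+1) = totient (3 ^ e.+1).
Proof.
have n0 : 0 < 3 ^ e.+1 by rewrite expn_gt0.
transitivity ((\sum_(x < 3 ^ e.+1) coprime 3 x) * \sum_(y < 3 ^ e.+1) (y == 0 :> nat)).
  rewrite -(sum_mul _ (coprime 3) (eq_op ^~ 0)).
  apply: eq_bigr => x _; apply: eq_bigr => y _; rewrite mulnb; congr nat_of_bool.
  rewrite /torsion_pair /unit_pair coprime_pexpl //.
  have -> : coprime 3 (x ^ 2 + 3 * y ^ 2) = coprime 3 x.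
    by rewrite addnC mulnC /coprime gcdnMDl -/(coprime 3 _) coprime_pexpr.
  have [cx|//] := boolP (coprime 3 x).
  rewrite mulnA Gauss_dvdr; last by rewrite coprime_pexpl // coprimeMr cx.
  rewrite /=; apply/idP/eqP => [|->//]; case: (nat_of_ord y) (ltn_ord y) => // z zn /dvdn_leq.
  by move=> /(_ isT); rewrite leqNgt zn.
by rewrite sum_eq0 // muln1 sum_coprime_pfactor.
Qed.

Lemma torsion_count_2 : pair_count torsion_pair 2 = 2.
Proof. by rewrite /pair_count !big_ord_recr !big_ord0. Qed.

(** The expression (p - 1)(p - (-3/p)), valid at odd primes, would give 3 here; the ratio 2/3 is
    what turns n/2 into n/3 for even n. *)
Lemma unit_count_2 : pair_count unit_pair 2 = 2.
Proof. by rewrite /pair_count !big_ord_recr !big_ord0. Qed.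

Lemma unit_count_3 : pair_count unit_pair 3 = 6.
Proof. by rewrite /pair_count !big_ord_recr !big_ord0. Qed.

(** Because of the factor 2 in 2xy, only half the modulus h has to divide xy. A unit has one even
    and one odd coordinate, and the even one is one of the two multiples of h, which doubles the
    usual 2 phi. *)
Lemma torsion_count_4 e :
  pair_count torsion_pair (2 ^ e.+2) = 4 * totient (2 ^ e.+2).
Proof.
pose h := 2 ^ e.+1; have n0 : 0 < h by rewrite expn_gt0.
have eh : 2 ^ e.+2 = h * 2 by rewrite expnSr.
have sd : \sum_(x < 2 ^ e.+2) (h %| x) = 2 by rewrite eh sum_dvd.
transitivity (\sum_(x < 2 ^ e.+2) \sum_(y < 2 ^ e.+2)
   ((h %| x) * coprime 2 y + coprime 2 x * (h %| y))); last first.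
  under eq_bigr => x _ do rewrite big_split.
  rewrite big_split /= (sum_mul _ (fun x => h %| x : nat) (fun y => coprime 2 y)).
  rewrite (sum_mul _ (fun y => coprime 2 y) (fun x => h %| x : nat)).
  by rewrite !sum_coprime_pfactor // sd; lia.
apply: eq_bigr => x _; apply: eq_bigr => y _.
rewrite /torsion_pair /unit_pair coprime_pexpl //.
have -> : (2 ^ e.+2 %| 2 * (x * y)) = (h %| x * y) by exact: (@dvdn_pmul2l 2).
rewrite !coprime2n oddD oddM !oddX /=.
have e2 z : h %| z -> ~~ odd z.
  by move=> hz; rewrite -dvdn2; apply: dvdn_trans hz; rewrite /h expnS dvdn_mulr.
have [ox|ox] := boolP (odd x); have [oy|oy] := boolP (odd y) => /=.
- have -> : (h %| x) = false by apply: contraTF ox => /e2.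
  by have -> : (h %| y) = false by apply: contraTF oy => /e2.
- rewrite muln0 add0n mul1n Gauss_dvdr //.
  by rewrite /h coprime_pexpl // coprime2n.
- rewrite muln1 mul0n addn0 Gauss_dvdl //.
  by rewrite /h coprime_pexpl // coprime2n.
- by rewrite muln0.
Qed.

End PairCount.

Lemma nrm_nat (x y : nat) : nrm (x%:Z, y%:Z) = (x ^ 2 + 3 * y ^ 2)%N%:Z.
Proof. by rewrite PoszD PoszM !expnS !expn0 !muln1 !PoszM /nrm /=; ring. Qed.

Lemma unit_pairE (n x y : nat) :
  coprimez n (nrm (x%:Z, y%:Z)) = unit_pair n x y.
Proof. by rewrite nrm_nat. Qed.

Lemma card_unit_points m : #|unit_points m| = pair_count unit_pair m.+1.
Proof.
rewrite /pair_count pair_bigA -sum1_card big_mkcond /=; apply: eq_bigr => u _.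
by rewrite !inE unit_pairE; case: unit_pair.
Qed.

Lemma card_two_torsion_points m :
  #|two_torsion_points m| = pair_count torsion_pair m.+1.
Proof.
rewrite /pair_count pair_bigA -sum1_card big_mkcond /=; apply: eq_bigr => u _.
by rewrite !inE unit_pairE /torsion_pair; case: (_ && _).
Qed.

(** * Norms prime to p, for a prime p > 3 *)

Section PrimeCount.
Variable m : nat.
Let p := m.+1.
Hypotheses (pp : prime p) (p3 : (3 < p)%N).

Lemma prime_dvdzM (a b : int) : (p %| a * b)%Z = (p %| a)%Z || (p %| b)%Z.
Proof. by rewrite !dvdzE abszM Euclid_dvdM. Qed.

Lemma prime_dvd_ord (x : 'I_p) : (p %| (x : nat)%:Z)%Z = (x == ord0).
Proof.
apply/idP/eqP => [h|->]; last exact: dvdz0.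
by apply: ord_dvd_inj; rewrite subr0.
Qed.

Lemma not_unit_pairE (x y : nat) :
  ~~ unit_pair p x y = (p %| nrm (x%:Z, y%:Z))%Z.
Proof. by rewrite /unit_pair prime_coprime // negbK nrm_nat. Qed.

Lemma kroneckerE : kronecker (- 3) p =
  if [exists x : 'I_p, (p %| (x : nat)%:Z ^+ 2 + 3)%Z] then 1 else - 1.
Proof.
rewrite /kronecker.
have -> : (p %| - 3)%Z = false.
  by apply/negP => /dvdn_leq => /(_ isT); rewrite /= leqNgt p3.
have -> : (p == 2%N) = false by apply/eqP; move: p3; lia.
by congr (if _ then _ else _); apply: eq_existsb => x; rewrite opprK.
Qed.

Lemma card_nonunit_row0 : #|[pred x : 'I_p | ~~ unit_pair p x 0]| = 1%N.
Proof.
apply: (@fintype.eq_card1 _ ord0) => x; rewrite !inE not_unit_pairE.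
have -> : nrm ((x : nat)%:Z, 0%N%:Z) = (x : nat)%:Z * (x : nat)%:Z by rewrite /nrm /=; ring.
by rewrite prime_dvdzM orbb prime_dvd_ord.
Qed.

(** Dividing by y reduces x^2 + 3y^2 = 0 modulo p to r^2 = -3, which has 1 + (-3/p) solutions. *)
Lemma card_nonunit_row (y : 'I_p) : y != ord0 ->
  (#|[pred x : 'I_p | ~~ unit_pair p x y]| : int) = 1 + kronecker (- 3) p.
Proof.
move=> y0; have py : ~~ (p %| (y : nat)%:Z)%Z by rewrite prime_dvd_ord.
have coy : coprimez (y : nat)%:Z p%:Z.
  by rewrite coprimez_sym coprimezE prime_coprime.
rewrite kroneckerE; case: existsP => [[r /dvdzP[k ek]]|nr]; last first.
  rewrite eq_card0 // => x; rewrite !inE not_unit_pairE; apply/negP => h.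
  (* c inverts y modulo p, so c x would be a square root of -3. *)
  apply: nr; have [c [d cd]] := Bezoutz (y : nat)%:Z p%:Z; rewrite (eqP coy) in cd.
  exists (residue m (c * (x : nat)%:Z)).
  have /dvdzP[l el] : (p %| (residue m (c * (x : nat)%:Z) : nat)%:Z - c * (x : nat)%:Z)%Z.
    by rewrite residueE -eqz_mod_dvd modz_mod.
  have {el}-> : (residue m (c * (x : nat)%:Z) : nat)%:Z = c * (x : nat)%:Z + l * p%:Z.
    by rewrite -el; ring.
  have {cd}cd : c * (y : nat)%:Z = 1 - d * p%:Z by rewrite -cd; ring.
  have -> : (c * (x : nat)%:Z + l * p%:Z) ^+ 2 + 3 =
     c ^+ 2 * nrm ((x : nat)%:Z, (y : nat)%:Z) + (2 * c * (x : nat)%:Z * l + l ^+ 2 * p%:Z) * p%:Z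
     + 3 * (1 - (c * (y : nat)%:Z) ^+ 2).
    by rewrite /nrm /=; ring.
  rewrite cd rpredD ?rpredD ?dvdz_mull //.
  by apply/dvdzP; exists (2 * d - d ^+ 2 * p%:Z); ring.
pose a := (r : nat)%:Z * (y : nat)%:Z.
have pr : ~~ (p %| (r : nat)%:Z)%Z.
  apply/negP => /dvdzP[l el]; have : (p %| 3)%Z.
    by apply/dvdzP; exists (k - l * (r : nat)%:Z); rewrite mulrBl -ek -mulrA [_ * p%:Z]mulrC mulrA -el; ring.
  by move/dvdn_leq => /(_ isT); rewrite /= leqNgt p3.
(* The two solutions are r y and - r y, distinct since p divides none of 2, r and y. *)
rewrite (_ : #|_| = #|pred2 (residue m a) (residue m (- a))|).
  rewrite card2; suff -> : residue m a != residue m (- a) by [].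
  apply/eqP => e; have : (p %| 2 * a)%Z.
    have -> : 2 * a = a - - a by ring.
    by rewrite -eqz_mod_dvd -!residueE e.
  rewrite !prime_dvdzM (negbTE pr) (negbTE py) !orbF.
  by move/dvdn_leq => /(_ isT); move: p3; rewrite /=; lia.
have resP (x : 'I_p) b : (x == residue m b) = (p %| (x : nat)%:Z - b)%Z.
  apply/eqP/idP => [->|h]; first by rewrite residueE -eqz_mod_dvd modz_mod.
  by apply/esym/eq_residue; rewrite -opprB rpredN.
apply: eq_card => x; rewrite !inE !resP opprK -prime_dvdzM not_unit_pairE.
have -> : nrm ((x : nat)%:Z, (y : nat)%:Z) =
   ((x : nat)%:Z - a) * ((x : nat)%:Z + a) + (y : nat)%:Z ^+ 2 * k * p%:Z.
  by rewrite -mulrA -ek /nrm /a /=; ring.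
by rewrite rpredDr // dvdz_mull.
Qed.

(** The complement is counted by rows: one point in the row y = 0 and 1 + (-3/p) points in each of
    the other p - 1 rows. *)
Lemma unit_count_prime :
  (pair_count unit_pair p)%:Z = (p%:Z - 1) * (p%:Z - kronecker (- 3) p).
Proof.
pose N := (\sum_(x < p) \sum_(y < p) ~~ unit_pair p x y)%N.
have eN : (pair_count unit_pair p + N = p ^ 2)%N.
  rewrite /pair_count /N -big_split /=.
  under eq_bigr => x _ do rewrite -big_split /=.
  under eq_bigr => x _ do under eq_bigr => y _ do rewrite addnC addn_negb.
  by rewrite !sum_nat_const !card_ord muln1.
have rowE (y : nat) : (\sum_(x < p) ~~ unit_pair p x y = #|[pred x : 'I_p | ~~ unit_pair p x y]|)%N.
  by rewrite -sum1_card [RHS]big_mkcond /=; apply: eq_bigr => x _; rewrite !inE; case: unit_pair.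
have : N%:Z = 1 + m%:Z * (1 + kronecker (- 3) p).
  rewrite /N exchange_big /= big_ord_recl rowE card_nonunit_row0 PoszD; congr (1 + _).
  rewrite (big_morph _ PoszD (erefl 0%:Z)) /=.
  transitivity (\sum_(y < m) (1 + kronecker (- 3) p)).
    by apply: eq_bigr => y _; rewrite rowE (card_nonunit_row (lift ord0 y)).
  by rewrite sumr_const card_ord -(natz m) mulr_natl.
have ep : p%:Z = m%:Z + 1 by rewrite /p -addn1 PoszD.
move=> e; have : (pair_count unit_pair p)%:Z = p%:Z ^+ 2 - N%:Z.
  by rewrite -(addrK N%:Z (pair_count unit_pair p)%:Z) -PoszD eN expnS expn1 PoszM.
by rewrite e ep => ->; ring.
Qed.

End PrimeCount.

(** * From prime powers to arbitrary n *)

Lemma pfactor_ind (P : nat -> Prop) : P 1%N ->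
  (forall p e m, prime p -> coprime p m -> (0 < m)%N -> P m -> P (p ^ e.+1 * m)%N) ->
  forall n, (0 < n)%N -> P n.
Proof.
move=> P1 IP n; have [k] := ubnP n; elim: k n => // k IH n nk n0.
have [->//|n1] := eqVneq n 1%N.
have {}n1 : (1 < n)%N by rewrite ltn_neqAle eq_sym n1.
have pp := pdiv_prime n1; set p := pdiv n in pp.
have e0 : (0 < logn p n)%N by rewrite logn_gt0 mem_primes pp n0 pdiv_dvd.
have := partnC p n0; rewrite p_part -(prednK e0) => en.
have m0 : (0 < n`_p^')%N by exact: part_gt0.
rewrite -en; apply: IP => //.
  have := coprime_partC p n n; rewrite p_part coprime_pexpl //.
apply: IH => //; apply: leq_trans (_ : n <= k)%N => //.
rewrite -[ltnRHS]en -[ltnLHS]mul1n ltn_pmul2r //.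
by rewrite -(expn0 p) ltn_exp2l ?prime_gt1.
Qed.

Lemma primes_pfactor_mul p e m : prime p -> coprime p m -> (0 < m)%N ->
  perm_eq (primes (p ^ e.+1 * m)) (p :: primes m).
Proof.
move=> pp co m0; apply: uniq_perm; rewrite /= ?primes_uniq ?andbT //.
  by move: co; rewrite mem_primes prime_coprime // => /negbTE->; rewrite !andbF.
have q0 : (0 < p ^ e.+1)%N by rewrite expn_gt0 prime_gt0.
move=> q; rewrite primesM // primesX // primes_prime //.
by rewrite !in_cons orbF.
Qed.

Lemma omega_pfactor_mul p e m : prime p -> coprime p m -> (0 < m)%N ->
  omega (p ^ e.+1 * m) = (omega m).+1.
Proof. by move=> pp co m0; rewrite /omega (perm_size (primes_pfactor_mul _ _ _ pp co m0)). Qed.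

Lemma euler_factor_mul p e m : prime p -> coprime p m -> (0 < m)%N ->
  euler_factor (p ^ e.+1 * m) = (1 - (kronecker (- 3) p)%:~R / p%:R) * euler_factor m.
Proof.
by move=> pp co m0; rewrite /euler_factor (perm_big _ (primes_pfactor_mul _ _ _ pp co m0)) big_cons.
Qed.

Lemma totient_pfactor_mul p e m : prime p -> coprime p m ->
  totient (p ^ e.+1 * m) = (totient (p ^ e.+1) * totient m)%N.
Proof. by move=> pp co; rewrite totient_coprime // coprime_pexpl. Qed.

Lemma unit_count_pfactor_mul p e m : prime p -> coprime p m -> (0 < m)%N ->
  pair_count unit_pair (p ^ e.+1 * m) =
  (pair_count unit_pair (p ^ e.+1) * pair_count unit_pair m)%N.
Proof.
move=> pp co m0; apply: pair_count_mul => //; rewrite ?expn_gt0 ?prime_gt0 //.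
  by rewrite coprime_pexpl.
by move=> x y; exact: unit_pair_mul.
Qed.

Lemma torsion_count_pfactor_mul p e m : prime p -> coprime p m -> (0 < m)%N ->
  pair_count torsion_pair (p ^ e.+1 * m) =
  (pair_count torsion_pair (p ^ e.+1) * pair_count torsion_pair m)%N.
Proof.
move=> pp co m0; have co' : coprime (p ^ e.+1) m by rewrite coprime_pexpl.
apply: pair_count_mul => //; rewrite ?expn_gt0 ?prime_gt0 //.
by move=> x y; exact: torsion_pair_mul.
Qed.

Lemma odd_prime_cases p : prime p -> odd p -> p = 3 \/ (3 < p)%N.
Proof. by case: p => [|[|[|[|p]]]] // pp _; [left|right]. Qed.

Lemma unit_count_odd_prime p : prime p -> odd p ->
  (pair_count unit_pair p)%:Z = (p%:Z - 1) * (p%:Z - kronecker (- 3) p).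
Proof.
move=> pp /(odd_prime_cases _ pp)[->|p3]; first by rewrite unit_count_3.
by case: p pp p3 => // m pp p3; exact: unit_count_prime.
Qed.

Lemma unit_count_odd n : (0 < n)%N -> odd n ->
  (pair_count unit_pair n)%:R = (totient n)%:R * n%:R * euler_factor n :> rat.
Proof.
move: n; apply: pfactor_ind => [_|p e m pp co m0 IH].
  rewrite /euler_factor big_nil /pair_count !big_ord_recl !big_ord0.
  by rewrite /unit_pair.
rewrite oddM oddX /= => /andP[op om].
rewrite unit_count_pfactor_mul // totient_pfactor_mul // euler_factor_mul //.
rewrite !natrM IH // unit_count_pfactor // totient_pfactor //= !natrM natrX expnS natrM natrX.
have : (pair_count unit_pair p)%:R = (p%:R - 1) * (p%:R - (kronecker (- 3) p)%:~R) :> rat.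
  have /(congr1 (fun z : int => z%:~R : rat)) := unit_count_odd_prime _ pp op.
  by rewrite intrM !intrB.
move=> ->; have -> : p.-1%:R = p%:R - 1 :> rat by rewrite -{2}(prednK (prime_gt0 pp)) -natr1 addrK.
have p0 : p%:R != 0 :> rat by rewrite pnatr_eq0 -lt0n prime_gt0.
by field.
Qed.

Lemma torsion_count_odd n : (0 < n)%N -> odd n ->
  (2 * pair_count torsion_pair n = totient n * 2 ^ omega (3 * n))%N.
Proof.
move: n; apply: pfactor_ind => [_|p e m pp co m0 IH].
  by rewrite /pair_count !big_ord_recl !big_ord0.
rewrite oddM oddX /= => /andP[op om].
rewrite torsion_count_pfactor_mul // totient_pfactor_mul // mulnCA IH //.
have [p3|p3] := odd_prime_cases _ pp op.
  rewrite p3 in co *; rewrite torsion_count_3 mulnA; congr (_ * 2 ^ _)%N.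
  by rewrite (omega_pfactor_mul _ 0) // mulnA -expnS omega_pfactor_mul.
have co3 : coprime p (3 * m).
  by rewrite coprimeMr co andbT prime_coprime // dvdn_prime2 //; lia.
have -> : (3 * (p ^ e.+1 * m) = p ^ e.+1 * (3 * m))%N by rewrite mulnCA.
rewrite torsion_count_p // omega_pfactor_mul ?muln_gt0 // [(2 ^ _.+1)%N]expnS.
by rewrite [RHS]mulnACA [(_ * 2)%N]mulnC.
Qed.

Lemma even_factor n : (0 < n)%N -> ~~ odd n ->
  exists e m, [/\ n = (2 ^ e.+1 * m)%N, odd m & (0 < m)%N].
Proof.
move=> n0 en; have e0 : (0 < logn 2 n)%N by rewrite logn_gt0 mem_primes n0 dvdn2 en.
have := partnC 2%N n0; rewrite p_part -(prednK e0) => e.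
exists (logn 2 n).-1, (n`_2^')%N; split; [by []| |exact: part_gt0].
by have := coprime_partC 2%N n n; rewrite p_part coprime_pexpl // coprime2n.
Qed.

Lemma unit_count_even n : (0 < n)%N -> ~~ odd n ->
  3 * (pair_count unit_pair n)%:R = 2 * (totient n)%:R * n%:R * euler_factor n :> rat.
Proof.
move=> n0 /(even_factor _ n0)[e [m [-> om m0]]].
have co : coprime 2 m by rewrite coprime2n.
rewrite unit_count_pfactor_mul // totient_pfactor_mul // euler_factor_mul //.
rewrite unit_count_pfactor // totient_pfactor // unit_count_2 !natrM unit_count_odd //.
have -> : kronecker (- 3) 2 = - 1 by [].
by rewrite /= !natrX exprS; field.
Qed.

(** When n is twice an odd number the quotient 3n/2 is odd, and when 4 | n the prime 2 survives in
    it; its extra factor 2 in the power matches the doubled count at higher powers of 2. *)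
Lemma torsion_count_even n : (0 < n)%N -> ~~ odd n ->
  (pair_count torsion_pair n = totient n * 2 ^ omega (3 * n %/ 2))%N.
Proof.
move=> n0 /(even_factor _ n0)[e [m [-> om m0]]].
have co : coprime 2 m by rewrite coprime2n.
have co3 : coprime 2 (3 * m) by rewrite coprimeMr co.
rewrite torsion_count_pfactor_mul // totient_pfactor_mul //.
have -> : (3 * (2 ^ e.+1 * m) %/ 2 = 2 ^ e * (3 * m))%N.
  by rewrite expnS mulnCA -!mulnA mulKn // mulnA [RHS]mulnCA mulnA.
have IH := torsion_count_odd _ m0 om.
case: e => [|e].
  have -> : totient (2 ^ 1) = 1%N by [].
  by rewrite expn0 !mul1n expn1 torsion_count_2 IH.
rewrite omega_pfactor_mul ?muln_gt0 // torsion_count_4 [(2 ^ (omega _).+1)%N]expnS.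
by move: IH; move: (totient (2 ^ _)) (2 ^ omega _)%N (totient m) (pair_count _ _); clear; nia.
Qed.

Lemma card_root_forms_formula n : (0 < n)%N ->
  #|root_forms n.-1|%:R =
      (if odd n then
         n%:R / 2 * euler_factor n + 2 ^ ((omega (3 * n))%:Z - 2)
       else
         n%:R / 3 * euler_factor n + 2 ^ ((omega (3 * n %/ 2))%:Z - 1)) :> rat.
Proof.
move=> n0; have := card_root_forms n.-1.
move: #|root_forms n.-1| => N.
rewrite card_unit_points card_two_torsion_points prednK //.
move/(congr1 (fun k : nat => k%:R : rat)); rewrite natrD !natrM => h.
have t0 : (totient n)%:R != 0 :> rat by rewrite pnatr_eq0 -lt0n totient_gt0.
case: ifPn => on.
  have hu := unit_count_odd _ n0 on.
  have /(congr1 (fun k : nat => k%:R : rat)) := torsion_count_odd _ n0 on.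
  rewrite !natrM natrX => ht.
  rewrite expfzDr // -[2 ^ (- 2)]/(4^-1) -exprnP.
  apply: (mulfI t0); apply: (mulfI (_ : 2 != 0)) => //.
  rewrite mulrA -h hu [X in _ + X](_ : _ = (totient n)%:R * 2 ^+ omega (3 * n) / 2); first by field.
  by rewrite -ht; field.
have hu := unit_count_even _ n0 on.
have /(congr1 (fun k : nat => k%:R : rat)) := torsion_count_even _ n0 on.
rewrite !natrM natrX => ht.
rewrite expfzDr // -[2 ^ (- 1)]/(2^-1) -exprnP.
apply: (mulfI t0); apply: (mulfI (_ : 2 != 0)) => //.
rewrite mulrA -h ht; apply: (mulfI (_ : 3 != 0)) => //.
by rewrite mulrDr hu; field.
Qed.

Local Open Scope classical_set_scope.
Local Open Scope ring_scope.

(** * 4-wheels and descent *)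

Lemma ord4P (P : 'I_4 -> Prop) : P 0 -> P 1 -> P 2 -> P 3 -> forall i, P i.
Proof.
move=> P0 P1 P2 P3 [[|[|[|[|k]]]] hk] //.
- by rewrite (_ : Ordinal hk = 0) //; apply: val_inj.
- by rewrite (_ : Ordinal hk = 1) //; apply: val_inj.
- by rewrite (_ : Ordinal hk = 2) //; apply: val_inj.
- by rewrite (_ : Ordinal hk = 3) //; apply: val_inj.
Qed.

Section Wheels.
Variable R : realType.
Implicit Types (C D E O : circle R) (W Y : 'I_4 -> circle R) (i j k : 'I_4).

(* Indices of circles are added modulo 4: W (i + 1) and W (i + 3) are the neighbours of W i. *)
Definition gram W := forall i j,
  cprod (W i) (W j) = if i == j then 1 else if odd (i + j)%N then -1 else -2.

Lemma circleP C D : curv C = curv D -> cocurv C = cocurv D ->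
  cen_re C = cen_re D -> cen_im C = cen_im D -> C = D.
Proof. by case: C D => [? ? ? ?] [? ? ? ?] /= -> -> -> ->. Qed.

Lemma cprodC C D : cprod C D = cprod D C.
Proof. by rewrite /cprod; ring. Qed.

Lemma odd_ord4D i j k : odd ((i + j)%R + (i + k)%R)%N = odd (j + k)%N.
Proof. by elim/ord4P: i; elim/ord4P: j; elim/ord4P: k. Qed.

Lemma odd_ord4B i j k : odd ((k - i)%R + (k - j)%R)%N = odd (i + j)%N.
Proof. by elim/ord4P: i; elim/ord4P: j; elim/ord4P: k. Qed.

Lemma gram_shift W i : gram W -> gram (fun j => W (i + j)).
Proof. by move=> gW j k; rewrite gW odd_ord4D (inj_eq (addrI i)). Qed.

Lemma gram_flip W k : gram W -> gram (fun j => W (k - j)).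
Proof.
by move=> gW i j; rewrite gW odd_ord4B (inj_eq (addrI k)) (inj_eq oppr_inj).
Qed.

Definition coord C (j : 'I_4) : R :=
  if val j == 0%N then curv C else if val j == 1%N then cocurv C
  else if val j == 2%N then cen_re C else cen_im C.
Definition dual_coord C (j : 'I_4) : R :=
  if val j == 0%N then - cocurv C / 2 else if val j == 1%N then - curv C / 2
  else if val j == 2%N then cen_re C else cen_im C.

Lemma cprod_coord C D : cprod C D = \sum_j coord C j * dual_coord D j.
Proof. by rewrite !big_ord_recl big_ord0 /cprod /coord /dual_coord /=; ring. Qed.

Definition gram_inverse : 'M[R]_4 := \matrix_(i, j)
  (if i == j then 1 / 3 else if odd (i + j)%N then - 1 / 3 else 0).

(** The Gram matrix is invertible, with the explicit inverse [gram_inverse], so the four vectors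
    span the space. [dual_coord] turns the product into an ordinary scalar product, which makes this
    a statement about square matrices. *)
Lemma gram_nondegenerate W E : gram W -> (forall i, cprod (W i) E = 0) ->
  E = Circle 0 0 0 0.
Proof.
move=> gW oE.
pose M := \matrix_(i, j) coord (W i) j; pose N := \matrix_(j, i) dual_coord (W i) j.
have MN : M *m (N *m gram_inverse) = 1%:M.
  rewrite mulmxA; apply/matrixP => i k; rewrite mxE.
  have MNE i' l : (M *m N) i' l = cprod (W i') (W l).
    by rewrite mxE cprod_coord; apply: eq_bigr => j _; rewrite !mxE.
  under eq_bigr => l _ do rewrite MNE gW !mxE.
  rewrite mxE !big_ord_recl big_ord0.
  by elim/ord4P: i; elim/ord4P: k; rewrite /=; field.
have e0 : \col_j dual_coord E j = 0.
  rewrite -[LHS]mul1mx -(mulmx1C MN) -mulmxA.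
  rewrite (_ : M *m _ = 0) ?mulmx0 //; apply/colP => i; rewrite !mxE -[RHS](oE i) cprod_coord.
  by apply: eq_bigr => j _; rewrite !mxE.
have eE j : dual_coord E j = 0 by move/colP: e0 => /(_ j); rewrite !mxE.
apply: circleP => /=.
- by move: (eE 1); rewrite /dual_coord /=; lra.
- by move: (eE 0); rewrite /dual_coord /=; lra.
- exact: (eE 2).
- exact: (eE 3).
Qed.

Definition swapped C D E : circle R :=
  Circle (2 * (curv D + curv E) - curv C) (2 * (cocurv D + cocurv E) - cocurv C)
    (2 * (cen_re D + cen_re E) - cen_re C) (2 * (cen_im D + cen_im E) - cen_im C).

Definition swapf i W j : circle R :=
  if j == i then swapped (W i) (W (i + 1)) (W (i + 3)) else W j.

(** The vector W 1 + W 3 - W 0 is orthogonal to W 1, W 2, W 3 and has product -3 with W 0 and 3 with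
    itself. By nondegeneracy O is t times it, and 3 t^2 = 1 makes the reflection integral. *)
Lemma swap0_swapped W O : gram W -> cprod O O = 1 ->
  cprod O (W 1) = 0 -> cprod O (W 2) = 0 -> cprod O (W 3) = 0 ->
  inversion O (W 0) = swapped (W 0) (W 1) (W 3).
Proof.
move=> gW OO O1 O2 O3; pose t := - cprod O (W 0) / 3.
pose E := Circle (curv O - t * (curv (W 1) + curv (W 3) - curv (W 0)))
   (cocurv O - t * (cocurv (W 1) + cocurv (W 3) - cocurv (W 0)))
   (cen_re O - t * (cen_re (W 1) + cen_re (W 3) - cen_re (W 0)))
   (cen_im O - t * (cen_im (W 1) + cen_im (W 3) - cen_im (W 0))).
have EE C : cprod C E = cprod C O - t * (cprod C (W 1) + cprod C (W 3) - cprod C (W 0)).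
  by rewrite /cprod /E /=; ring.
have E0 : E = Circle 0 0 0 0.
  apply: (gram_nondegenerate _ _ gW); apply: ord4P; rewrite EE !gW /= cprodC ?O1 ?O2 ?O3 /t; by field.
have [e1 e2 e3 e4] : [/\ curv O = t * (curv (W 1) + curv (W 3) - curv (W 0)),
   cocurv O = t * (cocurv (W 1) + cocurv (W 3) - cocurv (W 0)),
   cen_re O = t * (cen_re (W 1) + cen_re (W 3) - cen_re (W 0)) &
   cen_im O = t * (cen_im (W 1) + cen_im (W 3) - cen_im (W 0))].
  by case: E0 => *; split; apply/eqP; rewrite -subr_eq0; apply/eqP.
have t3 : 3 * t ^+ 2 = 1.
  have := EE O; rewrite E0 OO O1 O3.
  have -> : cprod O (W 0) = - 3 * t by rewrite /t; field.
  by rewrite /cprod /=; lra.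
have k : 2 * cprod (W 0) O = - 6 * t by rewrite cprodC /t; field.
rewrite /inversion k e1 e2 e3 e4.
have key x v : x - - 6 * t * (t * v) = x + 2 * v.
  by transitivity (x + 2 * (3 * t ^+ 2) * v); [ring|rewrite t3 mulr1].
by apply: circleP; rewrite /= key; ring.
Qed.

Lemma swap_swapf i W W' : gram W -> swap i W W' -> W' = swapf i W.
Proof.
move=> gW [O [OO ort Wi Wj]]; apply: funext => j; rewrite /swapf.
have [->|/Wj//] := eqVneq j i; rewrite Wi.
have := swap0_swapped (fun j => W (i + j)) O (gram_shift _ _ gW) OO.
rewrite addr0; apply; apply: ort; rewrite -subr_eq0 addrAC subrr add0r //.
Qed.

Lemma cprod_inversion O C D : cprod O O = 1 ->
  cprod (inversion O C) (inversion O D) = cprod C D.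
Proof.
move=> OO; transitivity (cprod C D + 4 * cprod C O * cprod D O * (cprod O O - 1)).
  by rewrite /inversion /cprod /=; field.
by rewrite OO subrr mulr0 addr0.
Qed.

Lemma inversion_orth O D : cprod O D = 0 -> inversion O D = D.
Proof.
by rewrite cprodC /inversion => ->; case: D => *; congr Circle; rewrite /=; ring.
Qed.

Lemma inversionK O C : cprod O O = 1 -> inversion O (inversion O C) = C.
Proof.
move=> OO; have e : cprod (inversion O C) O = - cprod C O.
  transitivity (cprod C O * (1 - 2 * cprod O O)); last by rewrite OO; ring.
  by rewrite /inversion /cprod /=; field.
by rewrite /inversion -/(inversion O C) e; apply: circleP; rewrite /=; ring.
Qed.

(** The inversion fixes the three circles orthogonal to O, so a swap acts on the whole wheel by one
    isometry. *)
Lemma swap_inversion i W W' : swap i W W' ->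
  exists2 O, cprod O O = 1 & W' = fun j => inversion O (W j).
Proof.
case=> O [OO ort Wi Wj]; exists O => //; apply: funext => j.
have [->//|ji] := eqVneq j i; by rewrite inversion_orth ?ort ?Wj.
Qed.

Lemma swap_gram i W W' : gram W -> swap i W W' -> gram W'.
Proof.
by move=> gW /swap_inversion[O OO ->] j k; rewrite cprod_inversion.
Qed.

Lemma swap_sym i W W' : swap i W W' -> swap i W' W.
Proof.
case=> O [OO ort Wi Wj]; exists O; split=> //.
- by move=> j ji; rewrite Wj // ort.
- by rewrite Wi inversionK.
- by move=> j ji; rewrite Wj.
Qed.

Lemma obtained_trans W1 W2 W3 : obtained W1 W2 -> obtained W2 W3 -> obtained W1 W3.
Proof. by move=> h; elim=> // i V V' _ h' s; apply: obtained_swap s. Qed.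

Lemma obtained_sym W1 W2 : obtained W1 W2 -> obtained W2 W1.
Proof.
elim=> [|i V V' _ h /swap_sym s]; first exact: obtained_refl.
by apply: obtained_trans h; apply: obtained_swap s; apply: obtained_refl.
Qed.

Lemma obtained_gram W1 W2 : gram W1 -> obtained W1 W2 -> gram W2.
Proof. by move=> gW; elim=> // i V V' _ gV /(swap_gram _ _ _ gV). Qed.

Lemma obtained_packing W1 W2 : obtained W1 W2 -> packing_of W1 = packing_of W2.
Proof.
move=> h; apply/seteqP; split=> C [V [i [hV ->]]]; exists V, i; split=> //.
  exact: obtained_trans (obtained_sym _ _ h) hV.
exact: obtained_trans h hV.
Qed.

Lemma obtained_flip k W1 W2 : obtained W1 W2 ->
  obtained (fun j => W1 (k - j)) (fun j => W2 (k - j)).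
Proof.
elim=> [|i V V' _ h [O [OO ort Wi Wj]]]; first exact: obtained_refl.
have kK j : k - (k - j) = j by rewrite opprB addrC subrK.
have neq j : j != k - i -> k - j != i by apply: contraNneq => <-; rewrite kK.
apply: (obtained_swap (i := k - i) h); exists O; split=> //.
- by move=> j /neq/ort.
- by rewrite kK.
- by move=> j /neq/Wj.
Qed.

(** The maps j to k - j on indices modulo 4 realise the relabellings: k = 2 exchanges entries 1 and
    3, k = 0 entries 2 and 4, and k = 1 the two pairs. *)
Lemma flip_packing k W : packing_of (fun j => W (k - j)) = packing_of W.
Proof.
have kK j : k - (k - j) = j by rewrite opprB addrC subrK.
have sub (V : 'I_4 -> circle R) : packing_of V `<=` packing_of (fun j => V (k - j)).
  move=> C [V' [i [h ->]]]; exists (fun j => V' (k - j)), (k - i).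
  by rewrite kK; split=> //; exact: (obtained_flip _ _ _ h).
apply/seteqP; split; last exact: sub.
have := sub (fun j => W (k - j)).
by rewrite (_ : (fun j => W (k - (k - j))) = W) //; apply: funext => j; rewrite kK.
Qed.

End Wheels.

Arguments gram {R} W.
Arguments swapf {R} i W j.

Section Descent.
Variable R : realType.
Implicit Types (C D E O : circle R) (W Y : 'I_4 -> circle R) (i j k : 'I_4).

(** The null vector (0, 1, 0, 0) of the point at infinity has product - u/2 with a circle of
    curvature u. The inverse Gram matrix expands it in the wheel, and the relation says that its own
    curvature is 0. *)
Lemma gram_eisenstein W : gram W ->
  curv (W 0) ^+ 2 + curv (W 1) ^+ 2 + curv (W 2) ^+ 2 + curv (W 3) ^+ 2 =
  2 * (curv (W 0) + curv (W 2)) * (curv (W 1) + curv (W 3)).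
Proof.
move=> gW; set a := curv (W 0); set b := curv (W 1).
set c := curv (W 2); set d := curv (W 3).
pose f (D : circle R -> R) (t : R) :=
  t + ((a - b - d) * D (W 0) + (b - a - c) * D (W 1) +
       (c - b - d) * D (W 2) + (d - a - c) * D (W 3)) / 6.
pose E := Circle (f (@curv R) 0) (f (@cocurv R) 1) (f (@cen_re R) 0) (f (@cen_im R) 0).
have EE C : cprod C E = - curv C / 2 + ((a - b - d) * cprod C (W 0) +
   (b - a - c) * cprod C (W 1) + (c - b - d) * cprod C (W 2) + (d - a - c) * cprod C (W 3)) / 6.
  by rewrite /cprod /E /f /=; field.
have /(congr1 (@curv R)) : E = Circle 0 0 0 0.
  apply: (gram_nondegenerate _ _ _ gW); apply: ord4P; rewrite EE !gW /= -?/a -?/b -?/c -?/d; by field.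
rewrite /E /f /= -/a -/b -/c -/d add0r => /eqP; rewrite mulf_eq0 invr_eq0 pnatr_eq0 orbF => /eqP e.
by apply/eqP; rewrite -subr_eq0; apply/eqP; rewrite -[RHS]e; ring.
Qed.

Lemma sum_ord4 (F : 'I_4 -> R) : \sum_j F j = F 0 + F 1 + F 2 + F 3.
Proof.
rewrite !big_ord_recl big_ord0 addr0 !addrA.
by congr (F _ + F _ + F _ + F _); apply: val_inj.
Qed.

Lemma qsum_curvatures W : qsum (curvatures W) = \sum_j curv (W j).
Proof. by rewrite sum_ord4. Qed.

Lemma wheel_shift i W : wheel W -> wheel (fun j => W (i + j)).
Proof.
case=> W0 gW; split; last exact: gram_shift.
by rewrite qsum_curvatures (reindex_inj (addrI i)) -qsum_curvatures in W0 *.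
Qed.

(** The first bound holds because (a + c)(b + d) is half a sum of squares. If a + b < 0, the
    products (a + b)(a + d) and (b + a)(b + c), which are halves of sums of squares, force a + d and
    b + c to be nonpositive. The third bound, positivity after a swap, follows from (a - c)^2 <= 3
    (b + d)^2. *)
Lemma eisenstein_sums (a b c d : R) :
  a ^+ 2 + b ^+ 2 + c ^+ 2 + d ^+ 2 = 2 * (a + c) * (b + d) -> 0 < a + b + c + d ->
  [/\ 0 < b + d, 0 <= a + b & a < 3 * (b + d) + c].
Proof.
move=> e s.
have bd : 0 < b + d.
  have h : 0 <= (a + c) * (b + d).
    have : 0 <= 2 * (a + c) * (b + d) by rewrite -e !addr_ge0 ?sqr_ge0.
    by rewrite -mulrA pmulr_rge0.
  rewrite ltNge; apply/negP => bd.
  have ac : 0 < a + c by lra.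
  have bd0 : b + d = 0.
    by apply/eqP; rewrite eq_le bd /= -(pmulr_rge0 _ ac).
  have : a ^+ 2 + b ^+ 2 + c ^+ 2 + d ^+ 2 = 0 by rewrite e bd0 mulr0.
  have : 0 < (a + c) ^+ 2 by rewrite exprn_gt0.
  by have := sqr_ge0 (a - c); have := sqr_ge0 b; have := sqr_ge0 d; lra.
split=> //.
  rewrite leNgt; apply/negP => ab.
  have h1 : 0 <= (a + b) * (a + d).
    have : 2 * ((a + b) * (a + d)) = 3 * a ^+ 2 + (b + d - c) ^+ 2 by lra.
    by have := sqr_ge0 a; have := sqr_ge0 (b + d - c); lra.
  have h2 : 0 <= (b + a) * (b + c).
    have : 2 * ((b + a) * (b + c)) = 3 * b ^+ 2 + (a + c - d) ^+ 2 by lra.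
    by have := sqr_ge0 b; have := sqr_ge0 (a + c - d); lra.
  have ad : a + d <= 0 by rewrite -(nmulr_rge0 _ ab).
  have bc : b + c <= 0 by rewrite addrC in ab; rewrite -(nmulr_rge0 _ ab).
  by lra.
rewrite ltNge; apply/negP => h.
have h1 : (a - c) ^+ 2 >= 9 * (b + d) ^+ 2.
  have : 0 <= (a - c - 3 * (b + d)) * (a - c + 3 * (b + d)) by rewrite mulr_ge0; lra.
  by lra.
have := sqr_ge0 (b - d); have := sqr_ge0 (a + c - 2 * (b + d)).
have : 0 < (b + d) ^+ 2 by rewrite exprn_gt0.
by lra.
Qed.

Lemma wheel_sums W i : wheel W ->
  [/\ 0 < curv (W (i + 1)) + curv (W (i + 3)), 0 <= curv (W i) + curv (W (i + 1)) &
   curv (W i) < 3 * (curv (W (i + 1)) + curv (W (i + 3))) + curv (W (i + 2))].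
Proof.
move=> /(wheel_shift i)[s /gram_eisenstein /=]; rewrite addr0 => e.
apply: (eisenstein_sums _ _ _ _ e); move: s; rewrite /curvatures /= addr0.
by rewrite !addrA.
Qed.

Lemma swapf_shift i j W : swapf i W (i + j) = swapf 0 (fun j => W (i + j)) j.
Proof.
by rewrite /swapf -[X in _ == X]addr0 (inj_eq (addrI i)) addr0 !add0r.
Qed.

Lemma swapf_sum i W : \sum_j curv (swapf i W j) =
  \sum_j curv (W j) + 2 * (curv (W (i + 1)) + curv (W (i + 3)) - curv (W i)).
Proof.
rewrite (reindex_inj (addrI i)) [X in _ = X + _](reindex_inj (addrI i)) !sum_ord4.
by rewrite !swapf_shift /swapf /= addr0 !add0r; ring.
Qed.

Lemma swapf_neq i j W : j != i -> swapf i W j = W j.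
Proof. by rewrite /swapf => /negbTE ->. Qed.

Lemma swapf_eq i W : swapf i W i = swapped _ (W i) (W (i + 1)) (W (i + 3)).
Proof. by rewrite /swapf eqxx. Qed.

Lemma odd_ord4S i j k : odd ((j - i)%R + (k - i)%R)%N = odd (j + k)%N.
Proof. by elim/ord4P: i; elim/ord4P: j; elim/ord4P: k. Qed.

Lemma cprod_swappedl C D E F : cprod (swapped _ C D E) F =
  2 * (cprod D F + cprod E F) - cprod C F.
Proof. by rewrite /cprod /=; field. Qed.

Lemma gram_swapf i W : gram W -> gram (swapf i W).
Proof.
move=> gW; have h0 (V : 'I_4 -> circle R) : gram V -> gram (swapf 0 V).
  move=> gV; have h j : j != 0 -> cprod (swapf 0 V 0) (V j) = if odd j then -1 else -2.
    rewrite swapf_eq cprod_swappedl !add0r !gV.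
    by elim/ord4P: j => //= _; ring.
  have h00 : cprod (swapf 0 V 0) (swapf 0 V 0) = 1.
    have h5 : cprod (swapf 0 V 0) (V 0) = - 5.
      by rewrite swapf_eq cprod_swappedl !add0r !gV /=; ring.
    rewrite {1}swapf_eq cprod_swappedl !add0r [cprod (V 0) _]cprodC h5.
    by rewrite [cprod (V 1) _]cprodC [cprod (V 3) _]cprodC !h //=; ring.
  have e j : j != 0 -> swapf 0 V j = V j by rewrite /swapf => /negbTE ->.
  move=> j k; have [->|j0] := eqVneq j 0; have [->|k0] := eqVneq k 0 => //.
  - by rewrite (e k) // h // eq_sym (negbTE k0).
  - by rewrite cprodC (e j) // h // (negbTE j0) addn0.
  - by rewrite (e j) // (e k).
have hi := h0 _ (gram_shift _ _ i gW).
move=> j k; have := hi (j - i) (k - i).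
by rewrite -!swapf_shift ![i + _]addrC !subrK => ->; rewrite (inj_eq (addIr _)) odd_ord4S.
Qed.

Lemma wheel_swapf i W : wheel W -> wheel (swapf i W).
Proof.
move=> wW; have [W0 gW] := wW; split; last exact: gram_swapf.
rewrite qsum_curvatures swapf_sum (reindex_inj (addrI i)) sum_ord4 addr0.
by have [_ _] := wheel_sums W i wW; lra.
Qed.

Lemma obtained_wheel W W' : wheel W -> obtained W W' -> wheel W'.
Proof.
move=> wW; elim=> // i V V' _ wV s; have [_ gV] := wV.
by rewrite (swap_swapf _ _ _ _ gV s); exact: wheel_swapf.
Qed.

(** Steps that preserve the curvature sum are included, since undoing a neutral swap also has to
    count as descent. *)
Inductive down : ('I_4 -> circle R) -> ('I_4 -> circle R) -> Prop :=
| down_refl W : down W W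
| down_step i W Y : curv (W (i + 1)) + curv (W (i + 3)) <= curv (W i) ->
    down (swapf i W) Y -> down W Y.

Definition reduced_wheel W :=
  forall i, curv (W i) <= curv (W (i + 1)) + curv (W (i + 3)).

Lemma ord4D (i : 'I_4) : [/\ i + 1 != i, i + 2 != i & i + 3 != i].
Proof. by elim/ord4P: i. Qed.

Lemma ord4_cases i j : [\/ j = i, j = i + 1, j = i + 2 | j = i + 3].
Proof.
by elim/ord4P: i; elim/ord4P: j; first [constructor 1; exact: val_inj
 |constructor 2; exact: val_inj|constructor 3; exact: val_inj|constructor 4; exact: val_inj].
Qed.

Lemma swapfK i W : swapf i (swapf i W) = W.
Proof.
apply: funext => j; have [->|ji] := eqVneq j i; last by rewrite !swapf_neq.
have [i1 _ i3] := ord4D i.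
rewrite !swapf_eq !swapf_neq //.
by apply: circleP; rewrite /=; ring.
Qed.

Lemma swapfC i W : swapf i (swapf (i + 2) W) = swapf (i + 2) (swapf i W).
Proof.
have [i1 i2 i3] := ord4D i.
have e k : i + 2 + k = i + (2 + k) by exact/esym/addrA.
have e1 : i + 2 + 1 = i + 3 by rewrite e; congr (_ + _); apply: val_inj.
have e3 : i + 2 + 3 = i + 1 by rewrite e; congr (_ + _); apply: val_inj.
have n1 : i + 1 != i + 2 by rewrite (inj_eq (addrI i)).
have n3 : i + 3 != i + 2 by rewrite (inj_eq (addrI i)).
apply: funext => j; have [->|ji] := eqVneq j i.
  by rewrite swapf_eq [RHS]swapf_neq 1?eq_sym // swapf_eq !swapf_neq // eq_sym.
have [->|ji2] := eqVneq j (i + 2); last by rewrite !swapf_neq.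
by rewrite swapf_neq // !swapf_eq e1 e3 !swapf_neq.
Qed.

(* Two adjacent swaps cannot both be non-increasing unless the sum of the two
   other curvatures is nonpositive, and opposite swaps commute: so a strictly
   decreasing swap can always be moved to the front of a descent. *)
Lemma down_swapf i W Y : wheel W -> down W Y -> reduced_wheel Y ->
  curv (W (i + 1)) + curv (W (i + 3)) < curv (W i) -> down (swapf i W) Y.
Proof.
move=> wW h rY; elim: h wW rY => {W Y} [W|j W Y hj h IH] wW rY hi.
  by have := rY i; rewrite leNgt hi.
have [_ s1 _] := wheel_sums W (i + 1) wW.
have [_ s2 _] := wheel_sums W (i + 2) wW.
have e a b c : a + b = c -> i + a + b = i + c by move=> <-; exact/esym/addrA.
have [ji|ji|ji|ji] := ord4_cases i j; subst j.
- exact: h.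
- rewrite (e 1 1 2) // (e 1 3 0) ?addr0 in hj; last exact: val_inj.
  rewrite (e 2 1 3) // in s2; last exact: val_inj.
  by lra.
- have [i1 i2 i3] := ord4D i.
  have n1 : i + 1 != i + 2 by rewrite (inj_eq (addrI i)).
  have n3 : i + 3 != i + 2 by rewrite (inj_eq (addrI i)).
  apply: (down_step (i + 2)).
    have e1 : i + 2 + 1 = i + 3 by rewrite (e _ _ 3) //; apply: val_inj.
    have e3 : i + 2 + 3 = i + 1 by rewrite (e _ _ 1) //; apply: val_inj.
    by move: hj; rewrite e1 e3 !swapf_neq.
  rewrite -swapfC; apply: IH => //; first exact: wheel_swapf.
  by rewrite !swapf_neq // eq_sym.
- have e1 : i + 3 + 1 = i by rewrite (e _ _ 0) ?addr0 //; exact: val_inj.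
  have e3 : i + 3 + 3 = i + 2 by apply: e; exact: val_inj.
  have e2 : i + 1 + 1 = i + 2 by apply: e; exact: val_inj.
  rewrite e1 e3 in hj; rewrite e2 in s1.
  by lra.
Qed.

(** Induction on the swaps: a strictly decreasing swap is absorbed by [down_swapf], and any other
    swap is undone by a non-increasing one put in front of the descent. *)
Lemma obtained_down W V : wheel W -> reduced_wheel W -> obtained W V -> down V W.
Proof.
move=> wW rW; elim=> [|i V1 V2 h IH s]; first exact: down_refl.
have wV := obtained_wheel _ _ wW h; have [_ gV] := wV.
rewrite (swap_swapf _ _ _ _ gV s).
have [lt|le] := ltP (curv (V1 (i + 1)) + curv (V1 (i + 3))) (curv (V1 i)).
  exact: down_swapf.
apply: (down_step i); last by rewrite swapfK.
have [i1 _ i3] := ord4D i.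
by rewrite swapf_eq !swapf_neq //=; lra.
Qed.

(** A circle moved by a non-increasing swap has curvature at least the sum of its neighbours, which
    is positive. *)
Lemma down_negative W Y i : wheel W -> down W Y -> curv (W i) < 0 -> Y i = W i.
Proof.
move=> wW h; elim: h wW => {W Y} // j W Y hj _ IH wW neg.
have ij : i != j.
  apply: contraTneq neg => ->; rewrite -leNgt; apply: le_trans hj.
  by have [/ltW] := wheel_sums W j wW.
by rewrite IH ?swapf_neq //; exact: wheel_swapf.
Qed.

(** Descent to W leaves C in place. Adjacent curvatures of W have nonnegative sum and opposite ones
    positive sum, so only W 0 can be negative. *)
Lemma negative_circle W C : wheel W -> reduced_wheel W -> curv (W 0) < 0 ->
  packing_of W C -> curv C < 0 -> C = W 0.
Proof.
move=> wW rW W0 [V [i [h ->]]] neg.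
have eV := down_negative _ _ _ (obtained_wheel _ _ wW h) (obtained_down _ _ wW rW h) neg.
rewrite -eV in neg *; congr W; apply/eqP; apply: contraTT neg => i0; rewrite -leNgt.
have [s02 s01 _] := wheel_sums W 0 wW; have [_ s30 _] := wheel_sums W 3 wW.
have [s13 _ _] := wheel_sums W 1 wW.
rewrite add0r in s01; rewrite (_ : 3 + 1 = 0) in s30; last exact: val_inj.
rewrite (_ : 1 + 1 = 2) // (_ : 1 + 3 = 0) in s13; last exact: val_inj.
by elim/ord4P: i i0 {h eV} => // _; lra.
Qed.

End Descent.

(** * Euclidean motions *)

Section Motions.
Variable R : realType.
Implicit Types (C D E O : circle R) (W Y : 'I_4 -> circle R) (i j k : 'I_4).
Implicit Types (f g : circle R -> circle R) (b : bool) (c s x y : R) (P Q : set (circle R)).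

Definition is_motion f := exists b c s x y,
  c ^+ 2 + s ^+ 2 = 1 /\ forall C, f C = motion b c s x y C.

Lemma cprod_motion b c s x y C D : c ^+ 2 + s ^+ 2 = 1 ->
  cprod (motion b c s x y C) (motion b c s x y D) = cprod C D.
Proof.
move=> h.
transitivity (cprod (rotate c s (if b then reflect_conj C else C))
                (rotate c s (if b then reflect_conj D else D))).
  by rewrite /motion /translate /cprod /=; field.
case: b; transitivity (- (curv C * cocurv D) / 2 - (curv D * cocurv C) / 2 +
  (c ^+ 2 + s ^+ 2) * (cen_re C * cen_re D + cen_im C * cen_im D));
  by [rewrite /cprod /=; ring|rewrite h mul1r addrA].
Qed.

Lemma is_motion_cprod f C D : is_motion f -> cprod (f C) (f D) = cprod C D.
Proof. by case=> b [c [s [x [y [h e]]]]]; rewrite !e cprod_motion. Qed.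

Lemma is_motion_curv f C : is_motion f -> curv (f C) = curv C.
Proof. by case=> b [c [s [x [y [h e]]]]]; rewrite !e; case: b {e}. Qed.

Lemma is_motion_inversion f O C : is_motion f ->
  f (inversion O C) = inversion (f O) (f C).
Proof.
move=> mf; rewrite /inversion is_motion_cprod //.
have [b [c [s [x [y [h e]]]]]] := mf; rewrite !e.
by case: b e => e; apply: circleP; rewrite /=; ring.
Qed.

Lemma is_motion_comp f g : is_motion f -> is_motion g -> is_motion (fun C => f (g C)).
Proof.
case=> b1 [c1 [s1 [x1 [y1 [h1 e1]]]]] [b2 [c2 [s2 [x2 [y2 [h2 e2]]]]]].
(* Moving the conjugation of f past g conjugates the rotation and the translation of g. *)
pose t2 := if b1 then - s2 else s2; pose z2 := if b1 then - y2 else y2.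
have ht : c2 ^+ 2 + t2 ^+ 2 = 1 by rewrite /t2; case: b1 {e1 t2 z2}; rewrite ?sqrrN.
exists (b1 (+) b2), (c1 * c2 - s1 * t2), (c1 * t2 + s1 * c2),
  (c1 * x2 - s1 * z2 + x1), (s1 * x2 + c1 * z2 + y1); split.
  transitivity ((c1 ^+ 2 + s1 ^+ 2) * (c2 ^+ 2 + t2 ^+ 2)); first by ring.
  by rewrite h1 ht mulr1.
have h1' : c1 ^+ 2 = 1 - s1 ^+ 2 by rewrite -h1; ring.
move=> C; rewrite e1 e2 /t2 /z2.
by case: b1 {e1 t2 z2 ht}; case: b2 {e2}; apply: circleP; rewrite /=; ring: h1'.
Qed.

Lemma is_motion_inv f : is_motion f ->
  exists g, [/\ is_motion g, cancel f g & cancel g f].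
Proof.
case=> b [c [s [x [y [h e]]]]].
pose t := if b then s else - s; pose z := if b then c * y - s * x else s * x - c * y.
have ht : c ^+ 2 + t ^+ 2 = 1 by rewrite /t; case: b {e t z}; rewrite ?sqrrN.
have h' : c ^+ 2 = 1 - s ^+ 2 by rewrite -h; ring.
exists (motion b c t (- (c * x + s * y)) z); split.
- by exists b, c, t, (- (c * x + s * y)), z.
- move=> C; rewrite e /t /z.
  by case: b {e t z ht}; apply: circleP; rewrite /=; ring: h'.
- move=> C; rewrite e /t /z.
  by case: b {e t z ht}; apply: circleP; rewrite /=; ring: h'.
Qed.

Lemma congruentE P Q : congruent P Q <-> exists2 f, is_motion f & Q = f @` P.
Proof.
split=> [[b [c [s [x [y [h ->]]]]]]|[f [b [c [s [x [y [h e]]]]]] ->]].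
  by exists (motion b c s x y) => //; exists b, c, s, x, y.
by exists b, c, s, x, y; split=> //; congr (_ @` _); apply: funext.
Qed.

Lemma congruent_refl P : congruent P P.
Proof.
exists false, 1, 0, 0, 0; split; first by rewrite expr0n expr1n addr0.
rewrite (_ : motion _ _ _ _ _ = id) ?image_id //; apply: funext => C.
by apply: circleP; rewrite /=; ring.
Qed.

Lemma congruent_trans P1 P2 P3 : congruent P1 P2 -> congruent P2 P3 -> congruent P1 P3.
Proof.
move=> /congruentE[f mf ->] /congruentE[g mg ->]; apply/congruentE.
by exists (fun C => g (f C)); [exact: is_motion_comp|rewrite image_comp].
Qed.

Lemma congruent_sym P Q : congruent P Q -> congruent Q P.
Proof.
move=> /congruentE[f mf ->]; apply/congruentE; have [g [mg fg gf]] := is_motion_inv _ mf.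
exists g => //; rewrite image_comp (_ : _ \o _ = id) ?image_id //.
by apply: funext => C /=; rewrite fg.
Qed.

Lemma congruence_classE P Q :
  congruence_class P = congruence_class Q <-> congruent P Q.
Proof.
split=> [e|pq].
  have : congruence_class Q Q by exact: congruent_refl.
  by rewrite -e.
apply/seteqP; split=> S /=; apply: congruent_trans => //.
exact: congruent_sym.
Qed.

Lemma obtained_motion f W V : is_motion f -> obtained W V ->
  obtained (fun j => f (W j)) (fun j => f (V j)).
Proof.
move=> mf; elim=> [|i V1 V2 h IH [O [OO ort Vi Vj]]]; first exact: obtained_refl.
apply: (obtained_swap IH); exists (f O); split.
- by rewrite is_motion_cprod.
- by move=> j /ort; rewrite is_motion_cprod.
- by rewrite Vi is_motion_inversion.
- by move=> j /Vj ->.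
Qed.

Lemma packing_motion f W : is_motion f ->
  packing_of (fun j => f (W j)) = f @` packing_of W.
Proof.
have sub g V : is_motion g -> g @` packing_of V `<=` packing_of (fun j => g (V j)).
  move=> mg _ [C [V' [i [h ->]]] <-]; exists (fun j => g (V' j)), i; split=> //.
  exact: obtained_motion.
move=> mf; apply/seteqP; split; last exact: sub.
have [g [mg fg gf]] := is_motion_inv _ mf.
move=> C hC; exists (g C); last exact: gf.
have := sub g (fun j => f (W j)) mg (g C) (ex_intro2 _ _ C hC erefl).
by rewrite (_ : (fun j => g (f (W j))) = W) //; apply: funext => j; rewrite fg.
Qed.

Lemma wheel_motion f W : is_motion f -> wheel W -> wheel (fun j => f (W j)).
Proof.
move=> mf [W0 gW]; split; first by move: W0; rewrite /curvatures !is_motion_curv.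
by move=> i j; rewrite is_motion_cprod.
Qed.

End Motions.

Arguments is_motion {R} f.

(** * Normal form of a wheel with given curvatures *)

Section Canonical.
Variable R : realType.
Variables n A B D : R.
Hypotheses (n0 : 0 < n) (A0 : 0 < A) (disc : 4 * A * D = B ^+ 2 + 3 * n ^+ 2).
Let r : R := Num.sqrt 3.

(** The outer circle is centred at 0 and the next one on the positive real axis; the other entries
    are solved from the Gram relations, up to a complex conjugation. *)
Definition canonical_wheel (i : 'I_4) : circle R :=
  let E := 2 * A + D - B in
  if val i == 0%N then Circle (- n) n^-1 0 0
  else if val i == 1%N then Circle (2 * A + n) ((2 * A - n) / n ^+ 2) (2 * A / n) 0
  else if val i == 2%N then
    Circle (E + 2 * n) ((E - 2 * n) / n ^+ 2)
      (E / n - 3 * n / (2 * A)) (- (r * (2 * A - B) / (2 * A)))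
  else Circle (D + n) ((D - n) / n ^+ 2) (D / n - 3 * n / (2 * A)) (r * B / (2 * A)).

Lemma sqrt3_sqr : r ^+ 2 = 3.
Proof. by rewrite sqr_sqrtr. Qed.

Let D_E : D = (B ^+ 2 + 3 * n ^+ 2) / (4 * A).
Proof. by rewrite -disc; field; rewrite gt_eqF. Qed.

Lemma canonical_gram : gram canonical_wheel.
Proof.
have n_0 : n != 0 by rewrite gt_eqF.
have A_0 : A != 0 by rewrite gt_eqF.
have r2 := sqrt3_sqr.
pose W := canonical_wheel.
have h00 : cprod (W 0) (W 0) = 1 by rewrite /cprod /=; field; rewrite ?n_0 ?A_0.
have h01 : cprod (W 0) (W 1) = -1 by rewrite /cprod /=; field; rewrite ?n_0 ?A_0.
have h02 : cprod (W 0) (W 2) = -2 by rewrite /cprod /=; field; rewrite ?n_0 ?A_0.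
have h03 : cprod (W 0) (W 3) = -1 by rewrite /cprod /=; field; rewrite ?n_0 ?A_0.
have h11 : cprod (W 1) (W 1) = 1 by rewrite /cprod /=; field; rewrite ?n_0 ?A_0.
have h12 : cprod (W 1) (W 2) = -1 by rewrite /cprod /=; field; rewrite ?n_0 ?A_0.
have h13 : cprod (W 1) (W 3) = -2 by rewrite /cprod /=; field; rewrite ?n_0 ?A_0.
have h22 : cprod (W 2) (W 2) = 1.
  by rewrite /cprod /= D_E; field: r2; rewrite ?n_0 ?A_0.
have h23 : cprod (W 2) (W 3) = -1.
  by rewrite /cprod /= D_E; field: r2; rewrite ?n_0 ?A_0.
have h33 : cprod (W 3) (W 3) = 1.
  by rewrite /cprod /= D_E; field: r2; rewrite ?n_0 ?A_0.
by move=> i j; elim/ord4P: i; elim/ord4P: j; rewrite /= // cprodC.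
Qed.

Lemma sqr_pair_eq (x y a b : R) : x ^+ 2 = a ^+ 2 -> y ^+ 2 = b ^+ 2 -> x * y = a * b ->
  (x = a /\ y = b) \/ (x = - a /\ y = - b).
Proof.
move=> /eqP; rewrite eqf_sqr => /orP[]/eqP -> /eqP; rewrite eqf_sqr => /orP[]/eqP -> h.
- by left.
- have /eqP : a * b = 0 by lra.
  by rewrite mulf_eq0 => /orP[]/eqP ->; rewrite oppr0; [right|left].
- have /eqP : a * b = 0 by lra.
  by rewrite mulf_eq0 => /orP[]/eqP ->; rewrite oppr0; [left|right].
- by right.
Qed.

(** Products with W 0 give the co-curvatures and products with W 1 the real parts. The last two
    imaginary parts are then known by their squares and their product, that is, up to a common
    sign. *)
Lemma gram_normal_form W : gram W -> curvatures W = curvatures canonical_wheel ->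
  cen_re (W 0) = 0 -> cen_im (W 0) = 0 -> cen_re (W 1) = 2 * A / n -> cen_im (W 1) = 0 ->
  W = canonical_wheel \/ (fun j => reflect_conj (W j)) = canonical_wheel.
Proof.
move=> gW eC p0 q0 p1 q1.
have n_0 : n != 0 by rewrite gt_eqF.
have A_0 : A != 0 by rewrite gt_eqF.
have r2 := sqrt3_sqr.
have [u0 u1 u2 u3] : [/\ curv (W 0) = - n, curv (W 1) = 2 * A + n,
   curv (W 2) = 2 * A + D - B + 2 * n & curv (W 3) = D + n].
  by case: eC => -> -> -> ->.
have v0 : cocurv (W 0) = n^-1.
  have := gW 0 0; rewrite /cprod p0 q0 u0 /= => h.
  by apply: (mulfI n_0); rewrite mulfV // -h; field.
have v1 : cocurv (W 1) = (2 * A - n) / n ^+ 2.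
  have := gW 0 1; rewrite /cprod p0 q0 u0 v0 u1 /= => h.
  apply: (mulfI n_0); transitivity (2 * -1 + (2 * A + n) / n).
    by rewrite -h; field.
  by field.
have v2 : cocurv (W 2) = (2 * A + D - B - 2 * n) / n ^+ 2.
  have := gW 0 2; rewrite /cprod p0 q0 u0 v0 u2 /= => h.
  apply: (mulfI n_0); transitivity (2 * -2 + (2 * A + D - B + 2 * n) / n).
    by rewrite -h; field.
  by field.
have v3 : cocurv (W 3) = (D - n) / n ^+ 2.
  have := gW 0 3; rewrite /cprod p0 q0 u0 v0 u3 /= => h.
  apply: (mulfI n_0); transitivity (2 * -1 + (D + n) / n).
    by rewrite -h; field.
  by field.
have p1_0 : 2 * A / n != 0 by rewrite lt0r_neq0 // divr_gt0 // mulr_gt0.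
have p3 : cen_re (W 3) = D / n - 3 * n / (2 * A).
  have := gW 1 3; rewrite /cprod p1 q1 u1 v1 u3 v3 /= => h.
  apply: (mulfI p1_0).
  transitivity (-2 + ((2 * A + n) * ((D - n) / n ^+ 2) + (D + n) * ((2 * A - n) / n ^+ 2)) / 2).
    by rewrite -h; field.
  by field; rewrite ?n_0 ?A_0.
have p2 : cen_re (W 2) = (2 * A + D - B) / n - 3 * n / (2 * A).
  have := gW 1 2; rewrite /cprod p1 q1 u1 v1 u2 v2 /= => h.
  apply: (mulfI p1_0).
  transitivity (-1 + ((2 * A + n) * ((2 * A + D - B - 2 * n) / n ^+ 2) +
     (2 * A + D - B + 2 * n) * ((2 * A - n) / n ^+ 2)) / 2).
    by rewrite -h; field.
  by field; rewrite ?n_0 ?A_0.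
have gC := canonical_gram.
have q3 : cen_im (W 3) ^+ 2 = (r * B / (2 * A)) ^+ 2.
  have := gW 3 3; rewrite -[RHS](gC 3 3) /cprod p3 u3 v3 /= -!expr2 => h.
  by move: h => /addrI.
have q2 : cen_im (W 2) ^+ 2 = (- (r * (2 * A - B) / (2 * A))) ^+ 2.
  have := gW 2 2; rewrite -[RHS](gC 2 2) /cprod p2 u2 v2 /= -!expr2 => h.
  by move: h => /addrI.
have q23 : cen_im (W 2) * cen_im (W 3) = - (r * (2 * A - B) / (2 * A)) * (r * B / (2 * A)).
  have := gW 2 3; rewrite -[RHS](gC 2 3) /cprod p2 u2 v2 p3 u3 v3 /= => h.
  by move: h => /addrI.
have [[e2 e3]|[e2 e3]] := sqr_pair_eq _ _ _ _ q2 q3 q23; [left|right].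
  by apply: funext; apply: ord4P; apply: circleP.
by apply: funext; apply: ord4P; apply: circleP; rewrite /= ?q0 ?q1 ?e2 ?e3 ?oppr0 ?opprK.
Qed.

Lemma motion_is_motion b c s x y : c ^+ 2 + s ^+ 2 = 1 -> is_motion (@motion R b c s x y).
Proof. by move=> h; exists b, c, s, x, y. Qed.

Lemma canonical_congruent W : gram W -> curvatures W = curvatures canonical_wheel ->
  exists2 f, is_motion f & canonical_wheel = (fun j => f (W j)).
Proof.
move=> gW eC.
have n_0 : n != 0 by rewrite gt_eqF.
have A_0 : A != 0 by rewrite gt_eqF.
have [u0 u1] : curv (W 0) = - n /\ curv (W 1) = 2 * A + n by case: eC => -> -> _ _.
(* The outer curvature is - n, so translation by the curvature-centre divided by n moves the centre
   to 0. *)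
pose f1 := motion false 1 0 (cen_re (W 0) / n) (cen_im (W 0) / n).
have m1 : is_motion f1.
  by apply: motion_is_motion; rewrite expr1n expr0n addr0.
pose W1 j := f1 (W j).
have g1 : gram W1 by move=> i j; rewrite is_motion_cprod.
have p10 : cen_re (W1 0) = 0 by rewrite /= u0; field.
have q10 : cen_im (W1 0) = 0 by rewrite /= u0; field.
have u10 : curv (W1 0) = - n by [].
have u11 : curv (W1 1) = 2 * A + n by [].
have v10 : cocurv (W1 0) = n^-1.
  have := g1 0 0; rewrite {1}/cprod p10 q10 u10 => h.
  by apply: (mulfI n_0); rewrite mulfV // -[RHS]h; field.
have v11 : cocurv (W1 1) = (2 * A - n) / n ^+ 2.
  have := g1 0 1; rewrite {1}/cprod p10 q10 u10 v10 u11 => h.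
  apply: (mulfI n_0); transitivity (2 * -1 + (2 * A + n) / n).
    by rewrite -[X in _ = 2 * X + _]h; field.
  by field.
have z1 : cen_re (W1 1) ^+ 2 + cen_im (W1 1) ^+ 2 = (2 * A / n) ^+ 2.
  have := g1 1 1; rewrite {1}/cprod u11 v11 => h.
  transitivity (1 + (2 * A + n) * ((2 * A - n) / n ^+ 2)); last by field.
  by move: h; rewrite /=; move: (_ * (_ / _)) => w; lra.
have cW1 j : curv (W1 j) = curv (W j) by [].
have eW1 : W1 = fun j => f1 (W j) by [].
clearbody W1.
have [k ek] : exists k, k = 2 * A / n by exists (2 * A / n).
have k_0 : k != 0 by rewrite ek lt0r_neq0 // divr_gt0 // mulr_gt0.
pose f2 := motion false (cen_re (W1 1) / k) (- cen_im (W1 1) / k) 0 0.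
have m2 : is_motion f2.
  apply: motion_is_motion.
  by rewrite !expr_div_n sqrrN -mulrDl z1 -ek divff // expf_neq0.
pose W2 j := f2 (W1 j).
have g2 : gram W2 by move=> i j; rewrite is_motion_cprod.
have eC2 : curvatures W2 = curvatures canonical_wheel.
  by rewrite -eC /curvatures -!cW1.
have p20 : cen_re (W2 0) = 0 by rewrite /= p10 q10; ring.
have q20 : cen_im (W2 0) = 0 by rewrite /= p10 q10; ring.
have p21 : cen_re (W2 1) = 2 * A / n.
  rewrite -ek; apply: (mulIf k_0); rewrite -[RHS]expr2 [in RHS]ek -[RHS]z1 /=; field.
  by rewrite k_0.
have q21 : cen_im (W2 1) = 0 by rewrite /=; ring.
have [e|e] := gram_normal_form _ g2 eC2 p20 q20 p21 q21.
  by exists (fun C => f2 (f1 C)); [exact: is_motion_comp|rewrite -e /W2 eW1].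
have mr : is_motion (@reflect_conj R).
  exists true, 1, 0, 0, 0; split; first by rewrite expr1n expr0n addr0.
  by move=> C; apply: circleP; rewrite /=; ring.
exists (fun C => reflect_conj (f2 (f1 C))); last by rewrite -e /W2 eW1.
by apply: is_motion_comp => //; exact: is_motion_comp.
Qed.

End Canonical.

(** * Root quadruples and packings *)

Section RootQuadruples.
Variable m : nat.
Let n : nat := m.+1.
Implicit Types D B A : int.

Definition form_quad D B A : quad int :=
  (- n%:Z, 2 * A + n%:Z, 2 * A + D - B + 2 * n%:Z, D + n%:Z).

Lemma form_quad_root D B A : root_form m D B A -> let x := form_quad D B A in
  [/\ eisenstein x, primitive_quad x, reduced x & standard_position x].
Proof.
move=> rf; have [D0 B0 A0] := root_form_pos _ _ _ _ rf.
have /andP[/and3P[/eqP disc oD prim] /and3P[_ BD BA]] := rf.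
rewrite -/n in disc; have n0 : 0 < n%:Z by [].
split.
- split; last by rewrite /=; lia.
  transitivity (2 * (- n%:Z + (2 * A + D - B + 2 * n%:Z)) * (2 * A + n%:Z + (D + n%:Z)) +
    (B ^+ 2 + 3 * n%:Z ^+ 2 - 4 * A * D)); first by ring.
  by rewrite disc; ring.
- rewrite /primitive_quad /form_quad.
  set g := gcdz _ _; have g1 : absz g = 1%N.
    apply/eqP/contraT => g1.
    have g0 : (0 < absz g)%N by rewrite absz_gt0 !gcdz_eq0 !negb_and oppr_eq0 gt_eqF.
    have pp : prime (pdiv (absz g)) by apply: pdiv_prime; rewrite ltn_neqAle eq_sym g1.
    have := pdiv_dvd (absz g); rewrite -[X in (X %| _)%N]/(absz (pdiv (absz g))%:Z) -dvdzE.
    move: (pdiv _) pp => p pp; rewrite !dvdz_gcd rpredN => /andP[/andP[pn pb] /andP[pc pd]].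
    have pD : (p%:Z %| D)%Z by rewrite -[D](addrK n%:Z) rpredB.
    have p2A : (p%:Z %| 2 * A)%Z by rewrite -[2 * A](addrK n%:Z) rpredB.
    have pB : (p%:Z %| B)%Z.
      have -> : B = 2 * A + D - (2 * A + D - B + 2 * n%:Z) + 2 * n%:Z by ring.
      by rewrite rpredD ?dvdz_mull // rpredB // rpredD.
    have p2 : (p%:Z %| 2)%Z = false.
      by apply/negP; rewrite dvdzE /= dvdn_prime2 // => /eqP p2; rewrite p2 in pD; case/negP: oD.
    have pA : (p%:Z %| A)%Z by move: p2A; rewrite !dvdzE abszM Euclid_dvdM // -!dvdzE p2.
    by have := elimT (prim_primeP _ _ _ oD) prim p pp pD pB pA.
  by rewrite -[LHS]/((absz g)%:Z) g1.
- by split; rewrite /=; lia.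
- have /dvdzP[k ek] := disc_parity _ _ _ _ disc.
  split; apply/eqP; rewrite eqz_mod_dvd; apply/dvdzP.
    by exists (- (A + n%:Z)); ring.
  by exists (A - k); rewrite mulrBl -ek; ring.
Qed.

(** The inequalities B >= 0, B <= D and B <= 2A express that S3, S2 and S4 do not decrease the
    sum. *)
Lemma root_quad_form b c d : let x := (- n%:Z, b, c, d) in
  eisenstein x -> primitive_quad x -> reduced x -> standard_position x ->
  exists D B A, root_form m D B A /\ x = form_quad D B A.
Proof.
move=> x [e s] prim [_ r2 r3 r4] [p1 p2]; have n0 : 0 < n%:Z by [].
have /dvdzP[A eA] : (2 %| b - n%:Z)%Z.
  have -> : b - n%:Z = - (- n%:Z - b) - n%:Z * 2 by ring.
  by rewrite rpredB ?dvdz_mull // rpredN -eqz_mod_dvd; apply/eqP.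
pose D := d - n%:Z; pose B := b + d - c.
have disc : 4 * A * D = B ^+ 2 + 3 * n%:Z ^+ 2.
  transitivity (2 * (A * 2) * D); first by ring.
  rewrite -eA /B /D; apply/eqP; rewrite -subr_eq0; apply/eqP.
  transitivity (2 * (- n%:Z + c) * (b + d) - ((- n%:Z) ^+ 2 + b ^+ 2 + c ^+ 2 + d ^+ 2)).
    by ring.
  by rewrite e subrr.
exists D, B, A; split; last first.
  by rewrite /x /form_quad /B /D; congr (_, _, _, _); move: eA; clear; lia.
move: r2 r3 r4; rewrite /= => r2 r3 r4.
have B0 : 0 <= B by rewrite /B; move: r3; clear; lia.
have BD : B <= D by rewrite /B /D; move: r2; clear; lia.
have BA : B <= 2 * A by rewrite /B mulrC -eA; move: r4; clear; lia.
(* With B = n + 2k the discriminant relation reads n^2 + nk + k^2 = AD. If D were even, n would be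
   even, then b, c, d as well, against primitivity. *)
have oD : ~~ (2 %| D)%Z.
  have /dvdzP[k ek] := disc_parity _ _ _ _ disc.
  have E2 (u v : int) : (2 %| u * v)%Z = (2 %| u)%Z || (2 %| v)%Z.
    by rewrite !dvdzE abszM Euclid_dvdM.
  apply/negP => eD; have : (2 %| n%:Z * n%:Z)%Z.
    have /dvdzP[D' eD'] := eD.
    have e2 : n%:Z * n%:Z + k * (n%:Z + k) = A * D' * 2.
      apply: (mulfI (_ : 4 != 0)) => //.
      transitivity ((n%:Z + k * 2) ^+ 2 + 3 * n%:Z ^+ 2); first by ring.
      have -> : n%:Z + k * 2 = B by rewrite -ek addrC subrK.
      by rewrite -disc eD'; ring.
    have {}e2 : n%:Z * n%:Z = A * D' * 2 - k * (n%:Z + k) by rewrite -e2 addrK.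
    have [k2|k2] := boolP (2 %| k)%Z; first by rewrite e2; apply: rpredB; [exact: dvdz_mull|exact: dvdz_mulr].
    have [n2|n2] := boolP (2 %| n%:Z + k)%Z; first by rewrite e2 rpredB ?dvdz_mull.
    by rewrite E2 orbb; move: (n%:Z) k2 n2 => n'; clear; lia.
  rewrite E2 orbb => en.
  have eB : (2 %| B)%Z by rewrite -(subrK n%:Z B) ek rpredD // dvdz_mull.
  have eb : (2 %| b)%Z by rewrite -(subrK n%:Z b) eA rpredD // dvdz_mull.
  have ed : (2 %| d)%Z by rewrite -(subrK n%:Z d) rpredD.
  have ecB : c = b + d - B by rewrite /B; ring.
  have ec : (2 %| c)%Z by rewrite ecB rpredB // rpredD.
  have : (2 %| gcdz (gcdz (- n%:Z) b) (gcdz c d))%Z by rewrite !dvdz_gcd rpredN en eb ec ed.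
  by rewrite prim.
rewrite /root_form /disc_form /reduced_form disc eqxx oD B0 BD BA !andbT /=.
apply/(prim_primeP _ _ _ oD) => p pp pD pB pA.
have pn := prime_dvd_disc _ _ _ _ _ pp disc pD pB pA.
have : (p%:Z %| gcdz (gcdz (- n%:Z) b) (gcdz c d))%Z.
  have eb : b = 2 * A + n%:Z by move: eA; clear; lia.
  have ed : d = D + n%:Z by rewrite /D subrK.
  have ec : c = b + d - B by rewrite /B; ring.
  have pb : (p%:Z %| b)%Z by rewrite eb rpredD // dvdz_mull.
  have pd : (p%:Z %| d)%Z by rewrite ed rpredD.
  by rewrite !dvdz_gcd rpredN pn pb pd ec rpredB // rpredD.
by rewrite prim dvdzE dvdn1 => /eqP /= p1'; rewrite p1' in pp.
Qed.

(** V is the curvature of the null vector. The Pythagorean equation bounds |k1| and |k3| by |h|, so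
    h <= 0 would make every term of V nonpositive; it also makes h - k1 - k3 even, and V is D (h -
    k1) modulo 2. *)
Lemma lattice_value D B A (k1 k2 k3 : int) : reduced_form D B A -> ~~ (2 %| D)%Z ->
  let h := k1 + k2 + k3 in
  let V := (2 * A - B) * (h - k3) + (D - B) * (h - k1) + B * h in
  h ^+ 2 = k1 ^+ 2 + k3 ^+ 2 -> 0 < V ->
  [/\ 0 < h, k1 <= h, k3 <= h & (2 %| V)%Z = (2 %| h - k1)%Z].
Proof.
move=> /and3P[B0 BD BA] oD h V eh V0.
have absle x : x ^+ 2 <= h ^+ 2 -> `|x| <= `|h|.
  by rewrite -[x ^+ 2]real_normK ?num_real // -[h ^+ 2]real_normK ?num_real // ler_pXn2r ?nnegrE.
have h1 : `|k1| <= `|h| by apply: absle; rewrite eh lerDl sqr_ge0.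
have h3 : `|k3| <= `|h| by apply: absle; rewrite eh lerDr sqr_ge0.
have h0 : 0 < h.
  rewrite ltNge; apply/negP => hle; move: V0; rewrite ltNge => /negP; apply.
  have e1 : h - k1 <= 0 by move: h1 hle; clearbody h; clear; lia.
  have e3 : h - k3 <= 0 by move: h3 hle; clearbody h; clear; lia.
  rewrite /V -oppr_ge0 !opprD -!mulrN.
  by rewrite !addr_ge0 // mulr_ge0 ?subr_ge0 ?oppr_ge0 //; move: BD BA; clear; lia.
split=> //; try by move: h1 h3 h0; clearbody h; clear; lia.
have even : (2 %| h - k1 - k3)%Z.
  have : (2 %| (h - k1 - k3) * (h - k1 - k3))%Z.
    apply/dvdzP; exists (h ^+ 2 - h * k1 - h * k3 + k1 * k3).
    transitivity (h ^+ 2 + (k1 ^+ 2 + k3 ^+ 2) - 2 * (h * k1) - 2 * (h * k3) + 2 * (k1 * k3)).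
      by ring.
    by rewrite -eh; ring.
  by rewrite !dvdzE abszM Euclid_dvdM // orbb.
have /dvdzP[q eq] := even.
have -> : V = D * (h - k1) + (A * (h - k3) - B * q) * 2.
  transitivity (D * (h - k1) + 2 * A * (h - k3) - B * (h - k1 - k3)); first by rewrite /V; ring.
  by rewrite eq; ring.
rewrite rpredDr; last exact: dvdz_mull.
by move: oD; rewrite !dvdzE abszM Euclid_dvdM // => /negbTE ->.
Qed.

(* [C_1 + C] is a null vector when the circle C of the packing is tangent to C_1;
   in the coordinates below being null is the Pythagorean equation of [lattice_value]. *)
Lemma lattice_min D B A D' A' (k0 k1 k2 k3 l0 l1 l2 l3 : int) :
  reduced_form D B A -> ~~ (2 %| D)%Z -> ~~ (2 %| D')%Z -> 0 < A' -> 0 < D' ->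
  k0 - k1 - 2 * k2 - k3 = - 1 -> l0 - l1 - 2 * l2 - l3 = - 1 ->
  k0 ^+ 2 + k1 ^+ 2 + k2 ^+ 2 + k3 ^+ 2 -
    2 * (k0 * k1 + 2 * k0 * k2 + k0 * k3 + k1 * k2 + 2 * k1 * k3 + k2 * k3) = 1 ->
  l0 ^+ 2 + l1 ^+ 2 + l2 ^+ 2 + l3 ^+ 2 -
    2 * (l0 * l1 + 2 * l0 * l2 + l0 * l3 + l1 * l2 + 2 * l1 * l3 + l2 * l3) = 1 ->
  k0 * l0 + k1 * l1 + k2 * l2 + k3 * l3 - (k0 * l1 + k1 * l0) - 2 * (k0 * l2 + k2 * l0)
    - (k0 * l3 + k3 * l0) - (k1 * l2 + k2 * l1) - 2 * (k1 * l3 + k3 * l1)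
    - (k2 * l3 + k3 * l2) = - 2 ->
  - n%:Z * k0 + (2 * A + n%:Z) * k1 + (2 * A + D - B + 2 * n%:Z) * k2 + (D + n%:Z) * k3
    = 2 * A' + n%:Z ->
  - n%:Z * l0 + (2 * A + n%:Z) * l1 + (2 * A + D - B + 2 * n%:Z) * l2 + (D + n%:Z) * l3
    = D' + n%:Z ->
  D <= D' /\ A <= A'.
Proof.
move=> r oD oD' A'0 D'0 ek el nk nl kl vk vl; have /and3P[B0 BD BA] := r.
have {}ek : k0 = k1 + 2 * k2 + k3 - 1 by move: ek; clear; lia.
have {}el : l0 = l1 + 2 * l2 + l3 - 1 by move: el; clear; lia.
subst k0 l0.
pose h := k1 + k2 + k3; pose g := l1 + l2 + l3.
have eh : h ^+ 2 = k1 ^+ 2 + k3 ^+ 2.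
  apply: (mulfI (_ : 3 != 0)) => //; apply/eqP; rewrite -subr_eq0; apply/eqP.
  move: nk; set N := (X in X = 1) => nk.
  by transitivity (1 - N); [rewrite /N /h; ring|rewrite nk subrr].
have eg : g ^+ 2 = l1 ^+ 2 + l3 ^+ 2.
  apply: (mulfI (_ : 3 != 0)) => //; apply/eqP; rewrite -subr_eq0; apply/eqP.
  move: nl; set N := (X in X = 1) => nl.
  by transitivity (1 - N); [rewrite /N /g; ring|rewrite nl subrr].
(* This is the product -2 of the two circles, rewritten for the two null vectors. *)
have ehg : h * g - k1 * l1 - k3 * l3 = 1.
  move: kl; set N := (X in X = - 2) => kl; apply: (mulfI (_ : - 3 != 0)) => //.
  by transitivity (N - 1); [rewrite /N /h /g; ring|rewrite kl].
pose V := (2 * A - B) * (h - k3) + (D - B) * (h - k1) + B * h.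
have eV : V = 2 * A'.
  by apply: (addIr n%:Z); rewrite -vk /V /h; ring.
pose U := (2 * A - B) * (g - l3) + (D - B) * (g - l1) + B * g.
have eU : U = D' by apply: (addIr n%:Z); rewrite -vl /U /g; ring.
have [|h0 h1 h3 hp] := lattice_value D B A k1 k2 k3 r oD eh; first by rewrite -/h -/V eV mulr_gt0.
have [|g0 g1 g3 gp] := lattice_value D B A l1 l2 l3 r oD eg; first by rewrite -/g -/U eU.
rewrite -/h -/V eV in hp h0 h1 h3; rewrite -/g -/U eU in gp g0 g1 g3.
split.
  (* D' is odd, so g - l1 is odd and cannot vanish. *)
  have gl : 1 <= g - l1.
    rewrite -gtz0_ge1 lt_neqAle subr_ge0 g1 andbT; apply/eqP => e.
    by move: oD'; rewrite gp -e.
  have s1 : 0 <= (2 * A - B) * (g - l3) by rewrite mulr_ge0 ?subr_ge0.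
  have s2 : 0 <= (D - B) * (g - l1 - 1) by rewrite mulr_ge0 ?subr_ge0.
  have s3 : 0 <= B * (g - 1) by rewrite mulr_ge0 ?subr_ge0 // -gtz0_ge1.
  by rewrite -eU -subr_ge0 (_ : _ - _ = (2 * A - B) * (g - l3) + (D - B) * (g - l1 - 1) + B * (g - 1));
    [rewrite !addr_ge0|rewrite /U; ring].
(* If h = k3 then k1 = 0, and evenness of 2A' makes h even; but [ehg] then says that h divides 1. *)
have hl : 1 <= h - k3.
  rewrite -gtz0_ge1 lt_neqAle subr_ge0 h3 andbT; apply/eqP => e.
  have ek3 : k3 = h by move: e; clearbody h; clear; lia.
  have k10 : k1 = 0.
    apply/eqP; rewrite -sqrf_eq0; move: eh; rewrite ek3.
    by move: (h ^+ 2) (k1 ^+ 2) => u v; clear; lia.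
  have : (2 %| h - k1)%Z by rewrite -hp dvdz_mulr.
  rewrite k10 subr0 => /dvdzP[q eq].
  by move: ehg; rewrite k10 ek3 mul0r subr0 -mulrBr eq -mulrA mulrCA; move: (q * _); clear; lia.
have s1 : 0 <= (2 * A - B) * (h - k3 - 1) by rewrite mulr_ge0 ?subr_ge0.
have s2 : 0 <= (D - B) * (h - k1) by rewrite mulr_ge0 ?subr_ge0.
have s3 : 0 <= B * (h - 1) by rewrite mulr_ge0 ?subr_ge0 // -gtz0_ge1.
rewrite -(ler_pM2l (_ : 0 < 2)) // -eV -subr_ge0.
by rewrite (_ : _ - _ = (2 * A - B) * (h - k3 - 1) + (D - B) * (h - k1) + B * (h - 1));
  [rewrite !addr_ge0|rewrite /V; ring].
Qed.

End RootQuadruples.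

(** * Classes of packings and root forms *)

Section Packings.
Variable R : realType.
Implicit Types (C : circle R) (W V : 'I_4 -> circle R) (P Q : set (circle R)).

Definition int_comb W (k0 k1 k2 k3 : int) : circle R :=
  let f (c : circle R -> R) := k0%:~R * c (W 0) + k1%:~R * c (W 1) +
    k2%:~R * c (W 2) + k3%:~R * c (W 3) in
  Circle (f (@curv R)) (f (@cocurv R)) (f (@cen_re R)) (f (@cen_im R)).

Lemma curv_int_comb W (k0 k1 k2 k3 : int) : curv (int_comb W k0 k1 k2 k3) =
  k0%:~R * curv (W 0) + k1%:~R * curv (W 1) + k2%:~R * curv (W 2) + k3%:~R * curv (W 3).
Proof. by []. Qed.

Lemma obtained_int_comb W V : gram W -> obtained W V ->
  forall i, exists k0 k1 k2 k3, V i = int_comb W k0 k1 k2 k3.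
Proof.
move=> gW; elim=> [|i V1 V2 h IH s] j.
  by elim/ord4P: j; [exists 1, 0, 0, 0|exists 0, 1, 0, 0|exists 0, 0, 1, 0|exists 0, 0, 0, 1];
    apply: circleP; rewrite /=; ring.
rewrite (swap_swapf _ _ _ _ (obtained_gram _ _ _ gW h) s) /swapf.
case: ifP => _; last exact: IH.
have [a0 [a1 [a2 [a3 ->]]]] := IH i.
have [b0 [b1 [b2 [b3 ->]]]] := IH (i + 1).
have [c0 [c1 [c2 [c3 ->]]]] := IH (i + 3).
exists (2 * (b0 + c0) - a0), (2 * (b1 + c1) - a1), (2 * (b2 + c2) - a2), (2 * (b3 + c3) - a3).
by apply: circleP; rewrite /=; ring.
Qed.

Lemma packing_int_comb W C : gram W -> packing_of W C ->
  exists k0 k1 k2 k3, C = int_comb W k0 k1 k2 k3.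
Proof. by move=> gW [V [i [h ->]]]; exact: obtained_int_comb. Qed.

Lemma cprod_int_comb W (k0 k1 k2 k3 l0 l1 l2 l3 : int) : gram W ->
  cprod (int_comb W k0 k1 k2 k3) (int_comb W l0 l1 l2 l3) =
  (k0 * l0 + k1 * l1 + k2 * l2 + k3 * l3 - (k0 * l1 + k1 * l0) - 2 * (k0 * l2 + k2 * l0)
    - (k0 * l3 + k3 * l0) - (k1 * l2 + k2 * l1) - 2 * (k1 * l3 + k3 * l1)
    - (k2 * l3 + k3 * l2))%:~R.
Proof.
move=> gW; pose g i j := cprod (W i) (W j).
transitivity (k0%:~R * l0%:~R * g 0 0 + k1%:~R * l1%:~R * g 1 1 + k2%:~R * l2%:~R * g 2 2
 + k3%:~R * l3%:~R * g 3 3 + (k0%:~R * l1%:~R + k1%:~R * l0%:~R) * g 0 1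
 + (k0%:~R * l2%:~R + k2%:~R * l0%:~R) * g 0 2 + (k0%:~R * l3%:~R + k3%:~R * l0%:~R) * g 0 3
 + (k1%:~R * l2%:~R + k2%:~R * l1%:~R) * g 1 2 + (k1%:~R * l3%:~R + k3%:~R * l1%:~R) * g 1 3
 + (k2%:~R * l3%:~R + k3%:~R * l2%:~R) * g 2 3).
  by rewrite /g /cprod /int_comb /=; field.
by rewrite /g !gW /=; ring.
Qed.

Lemma packing_self W i : packing_of W (W i).
Proof. by exists W, i; split=> //; exact: obtained_refl. Qed.

Lemma reduced_wheelP W : curv (W 0) <= curv (W 1) + curv (W 3) ->
  curv (W 1) <= curv (W 0) + curv (W 2) -> curv (W 2) <= curv (W 1) + curv (W 3) ->
  curv (W 3) <= curv (W 0) + curv (W 2) -> reduced_wheel R W.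
Proof.
move=> h0 h1 h2 h3.
have v (i j : 'I_4) : val i = val j -> curv (W i) = curv (W j) by move=> /val_inj ->.
apply: ord4P; rewrite ?add0r //.
- by rewrite (v (1 + 1) 2) // (v (1 + 3) 0) // addrC.
- by rewrite (v (2 + 1) 3) // (v (2 + 3) 1) // addrC.
- by rewrite (v (3 + 1) 0) // (v (3 + 3) 2).
Qed.

Lemma relabel_wheel (x y : quad R) : relabel x y -> forall W, wheel W -> curvatures W = x ->
  exists V, [/\ wheel V, packing_of V = packing_of W & curvatures V = y].
Proof.
have flip k (a b c d : R) y' (IH : forall W, wheel W -> curvatures W = (a, b, c, d) ->
    exists V, [/\ wheel V, packing_of V = packing_of W & curvatures V = y']) W :
    wheel W -> curvatures (fun j => W (k - j)) = (a, b, c, d) ->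
    exists V, [/\ wheel V, packing_of V = packing_of W & curvatures V = y'].
  move=> [W0 gW] eW; have gV := gram_flip _ _ k gW.
  have [|V [wV pV cV]] := IH _ _ eW.
    split=> //; move: W0; rewrite !qsum_curvatures.
    have inj : injective (fun j : 'I_4 => k - j) by move=> i j /addrI /oppr_inj.
    by rewrite (reindex_inj inj).
  by exists V; split=> //; rewrite pV flip_packing.
have v (W : 'I_4 -> circle R) (i j : 'I_4) : val i = val j -> curv (W i) = curv (W j).
  by move=> /val_inj ->.
elim=> [x' W wW eW|a b c d y' _ IH W wW eW|a b c d y' _ IH W wW eW|a b c d y' _ IH W wW eW].
- by exists W.
- apply: (flip 2 _ _ _ _ _ IH) => //; case: eW => <- <- <- <-.
  by congr (_, _, _, _); apply: v.
- apply: (flip 0 _ _ _ _ _ IH) => //; case: eW => <- <- <- <-.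
  by congr (_, _, _, _); apply: v.
- apply: (flip 1 _ _ _ _ _ IH) => //; case: eW => <- <- <- <-.
  by congr (_, _, _, _); apply: v.
Qed.

Lemma root_quadruple_wheel P x : root_quadruple P x ->
  exists W, [/\ wheel W, packing_of W = P & curvatures W = quad_int R x].
Proof.
case=> _ _ _ _ [_ [W [V [wW -> h rl]]]].
have wV := obtained_wheel _ _ _ wW h.
have [U [wU pU cU]] := relabel_wheel _ _ rl V wV erefl.
by exists U; rewrite pU -(obtained_packing _ _ _ h).
Qed.

Section FixedOuterCurvature.
Variable m : nat.
Let n : nat := m.+1.
Implicit Types D B A : int.

Lemma curvatures_quad_int W (a b c d : int) : curvatures W = quad_int R (a, b, c, d) ->
  [/\ curv (W 0) = a%:~R, curv (W 1) = b%:~R, curv (W 2) = c%:~R & curv (W 3) = d%:~R].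
Proof. by case. Qed.

Lemma form_wheel_reduced W D B A : root_form m D B A ->
  curvatures W = quad_int R (form_quad m D B A) -> reduced_wheel R W.
Proof.
move=> rf [e0 e1 e2 e3]; have [D0 B0 A0] := root_form_pos _ _ _ _ rf.
have /andP[_ /and3P[_ BD BA]] := rf.
by apply: reduced_wheelP; rewrite ?e0 ?e1 ?e2 ?e3 -intrD ler_int; lia.
Qed.

(** The wheels share their outer circle, the only negative circle of the packing. W' 1 and W' 3 are
    integral combinations of W, and their products with each other and with W' 0 are the hypotheses
    of [lattice_min]. *)
Lemma packing_form_le W W' D B A D' B' A' :
  root_form m D B A -> root_form m D' B' A' -> wheel W -> wheel W' ->
  curvatures W = quad_int R (form_quad m D B A) ->
  curvatures W' = quad_int R (form_quad m D' B' A') ->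
  packing_of W = packing_of W' -> D <= D' /\ A <= A'.
Proof.
move=> rf rf' wW wW' eW eW' eP.
have rW := form_wheel_reduced _ _ _ _ rf eW.
have [[_ gW] [_ gW']] := (wW, wW').
have [D'0 _ A'0] := root_form_pos _ _ _ _ rf'.
have /andP[/and3P[_ oD _] r] := rf; have /andP[/and3P[_ oD' _] _] := rf'.
case: eW eW' => u0 u1 u2 u3 [u0' u1' _ u3'].
have neg (z : R) : z = (- m.+1%:Z)%:~R -> z < 0 by move=> ->; rewrite ltrz0; lia.
have e0 : W' 0 = int_comb W 1 0 0 0.
  have -> : W' 0 = W 0.
    apply: (negative_circle _ _ _ wW rW); rewrite ?eP; [exact: neg|exact: packing_self|exact: neg].
  by apply: circleP; rewrite /=; ring.
have [|k0 [k1 [k2 [k3 ek]]]] := packing_int_comb W (W' 1) gW.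
  by rewrite eP; exact: packing_self.
have [|l0 [l1 [l2 [l3 el]]]] := packing_int_comb W (W' 3) gW.
  by rewrite eP; exact: packing_self.
have cp i j a0 a1 a2 a3 b0 b1 b2 b3 (z : int) :
    cprod (W' i) (W' j) = z%:~R -> W' i = int_comb W a0 a1 a2 a3 -> W' j = int_comb W b0 b1 b2 b3 ->
    a0 * b0 + a1 * b1 + a2 * b2 + a3 * b3 - (a0 * b1 + a1 * b0) - 2 * (a0 * b2 + a2 * b0)
    - (a0 * b3 + a3 * b0) - (a1 * b2 + a2 * b1) - 2 * (a1 * b3 + a3 * b1)
    - (a2 * b3 + a3 * b2) = z.
  by move=> e ei ej; apply: (@intr_inj R); rewrite -e ei ej cprod_int_comb.
have cu i a0 a1 a2 a3 (z : int) : curv (W' i) = z%:~R -> W' i = int_comb W a0 a1 a2 a3 ->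
    - m.+1%:Z * a0 + (2 * A + m.+1%:Z) * a1 + (2 * A + D - B + 2 * m.+1%:Z) * a2 + (D + m.+1%:Z) * a3 = z.
  move=> e ei; apply: (@intr_inj R); rewrite -e ei /= u0 u1 u2 u3.
  by rewrite -!intrM -!intrD; congr (_%:~R); ring.
apply: (lattice_min m D B A D' A' k0 k1 k2 k3 l0 l1 l2 l3) => //.
- by rewrite -[RHS](cp 1 0 _ _ _ _ _ _ _ _ (- 1) _ ek e0) ?gW' //; ring.
- by rewrite -[RHS](cp 3 0 _ _ _ _ _ _ _ _ (- 1) _ el e0) ?gW' //; ring.
- by rewrite -[RHS](cp 1 1 _ _ _ _ _ _ _ _ 1 _ ek ek) ?gW' //; ring.
- by rewrite -[RHS](cp 3 3 _ _ _ _ _ _ _ _ 1 _ el el) ?gW' //; ring.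
- by rewrite -[RHS](cp 1 3 _ _ _ _ _ _ _ _ (- 2) _ ek el) ?gW' //; ring.
- exact: (cu 1).
- exact: (cu 3).
Qed.

Lemma packing_form_inj W W' D B A D' B' A' :
  root_form m D B A -> root_form m D' B' A' -> wheel W -> wheel W' ->
  curvatures W = quad_int R (form_quad m D B A) ->
  curvatures W' = quad_int R (form_quad m D' B' A') ->
  packing_of W = packing_of W' -> [/\ D = D', B = B' & A = A'].
Proof.
move=> rf rf' wW wW' eW eW' eP.
have [h1 h2] := packing_form_le _ _ _ _ _ _ _ _ rf rf' wW wW' eW eW' eP.
have [h3 h4] := packing_form_le _ _ _ _ _ _ _ _ rf' rf wW' wW eW' eW (esym eP).
have eD : D = D' by apply/eqP; rewrite eq_le h1 h3.
have eA : A = A' by apply/eqP; rewrite eq_le h2 h4.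
split=> //; have [_ B0 _] := root_form_pos _ _ _ _ rf; have [_ B'0 _] := root_form_pos _ _ _ _ rf'.
have /andP[/and3P[/eqP disc _ _] _] := rf; have /andP[/and3P[/eqP disc' _ _] _] := rf'.
apply/eqP; rewrite -(eqrXn2 (isT : (0 < 2)%N)) //; apply/eqP.
by move: disc; rewrite eD eA disc' => /addIr.
Qed.

Definition form_wheel D B A : 'I_4 -> circle R :=
  canonical_wheel R n%:R A%:~R B%:~R D%:~R.

Lemma form_wheelP D B A : root_form m D B A ->
  wheel (form_wheel D B A) /\ curvatures (form_wheel D B A) = quad_int R (form_quad m D B A).
Proof.
move=> rf; have [D0 B0 A0] := root_form_pos _ _ _ _ rf.
have eC : curvatures (form_wheel D B A) = quad_int R (form_quad m D B A).
  by rewrite /curvatures /form_quad /= -/n; congr (_, _, _, _); ring.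
have [[_ s] _ _ _] := form_quad_root _ _ _ _ rf.
split=> //; split.
  by rewrite eC /= -!intrD ltr0z; exact: s.
apply: canonical_gram; rewrite ?ltr0n ?ltr0z //.
have /andP[/and3P[/eqP disc _ _] _] := rf.
transitivity ((4 * A * D)%:~R : R); first by ring.
by rewrite disc intrD intrM !rmorphXn.
Qed.

Lemma wheel_congruent_form W D B A : root_form m D B A -> wheel W ->
  curvatures W = quad_int R (form_quad m D B A) ->
  congruent (packing_of W) (packing_of (form_wheel D B A)).
Proof.
move=> rf [_ gW] eW; have [D0 B0 A0] := root_form_pos _ _ _ _ rf.
have [_ eC] := form_wheelP _ _ _ rf.
apply/congruentE; have [||||f mf e] := canonical_congruent R n%:R A%:~R B%:~R D%:~R _ _ _ W gW.
- by rewrite ltr0n.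
- by rewrite ltr0z.
- have /andP[/and3P[/eqP disc _ _] _] := rf.
  transitivity ((4 * A * D)%:~R : R); first by ring.
  by rewrite disc intrD intrM !rmorphXn.
- by rewrite eW -eC.
by exists f => //; rewrite -packing_motion // -e.
Qed.

Lemma form_packing_primitive D B A : root_form m D B A ->
  primitive_packing (packing_of (form_wheel D B A)) /\
  outer_curvature (packing_of (form_wheel D B A)) (- n%:Z).
Proof.
move=> rf; have [wW eC] := form_wheelP _ _ _ rf; have [_ gW] := wW.
have [eis prim red std] := form_quad_root _ _ _ _ rf.
split; last first.
  exists (2 * A + n%:Z), (2 * A + D - B + 2 * n%:Z), (D + n%:Z); split=> //.
  split; first by rewrite /= oppr_le0.
  exists (form_wheel D B A), (form_wheel D B A); split=> //; first exact: obtained_refl.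
  by rewrite eC; exact: relabel_refl.
have [u0 u1 u2 u3] := curvatures_quad_int _ _ _ _ _ eC.
split; first by exists (form_wheel D B A).
  move=> C /(packing_int_comb _ _ gW)[k0 [k1 [k2 [k3 ->]]]].
  by rewrite curv_int_comb u0 u1 u2 u3 -!intrM -!intrD intr_int.
move=> g hg; have dvd i (z : int) : curv (form_wheel D B A i) = z%:~R -> (g %| z)%Z.
  move=> e; have [z' e'] := hg _ (packing_self (form_wheel D B A) i).
  by apply/dvdzP; exists z'; apply: (@intr_inj R); rewrite -e e' mulrC.
have {}prim : gcdz (gcdz _ _) (gcdz _ _) = 1 := prim.
have : (g %| 1)%Z by rewrite -[X in (_ %| X)%Z]prim !dvdz_gcd !(dvd _ _ u0, dvd _ _ u1, dvd _ _ u2, dvd _ _ u3).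
by rewrite dvdzE dvdn1 => /eqP.
Qed.

Lemma packing_classes_card : (packing_classes R (- n%:Z) #= `I_#|root_forms m|)%card.
Proof.
pose t0 : 'I_(3 * m.+1 ^ 2).+1 := ord0.
pose t k := nth (t0, t0, t0) (enum (root_forms m)) k.
pose W k := form_wheel ((t k).1.1 : nat)%:Z ((t k).1.2 : nat)%:Z ((t k).2 : nat)%:Z.
have rf k : (k < #|root_forms m|)%N ->
    root_form m ((t k).1.1 : nat)%:Z ((t k).1.2 : nat)%:Z ((t k).2 : nat)%:Z.
  by move=> hk; have : t k \in root_forms m by rewrite -mem_enum mem_nth // -cardE.
pose g k := congruence_class (packing_of (W k)).
have -> : packing_classes R (- n%:Z) = g @` `I_#|root_forms m|.
  apply/seteqP; split=> [_ [P [prP [b [c [d rq]]]] <-]|_ [k hk <-]]; last first.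
    by exists (packing_of (W k)) => //; apply: form_packing_primitive; exact: rf.
  have [eis prim red std _] := rq.
  have [D [B [A [rfx ex]]]] := root_quad_form _ _ _ _ eis prim red std.
  have [V [wV pV cV]] := root_quadruple_wheel _ _ rq.
  have [s [e1 e2 e3]] := root_form_bound _ _ _ _ rfx.
  have hs : s \in root_forms m by rewrite inE -e1 -e2 -e3.
  have ts : t (index s (enum (root_forms m))) = s by rewrite /t nth_index // mem_enum.
  exists (index s (enum (root_forms m))); first by rewrite /= cardE index_mem mem_enum.
  apply/esym/congruence_classE; rewrite /W ts -e1 -e2 -e3 -pV.
  by apply: wheel_congruent_form => //; rewrite cV ex.
(* A motion between two packings carries one root wheel to a wheel with the same curvatures inside
   the other packing, so [packing_form_inj] identifies the two triples. *)
apply: inj_card_eq => i j; rewrite !inE => hi hj /congruence_classE/congruentE[f mf].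
rewrite -packing_motion // => eP.
have [wi ei] := form_wheelP _ _ _ (rf _ hi); have [wj ej] := form_wheelP _ _ _ (rf _ hj).
have [||e1 e2 e3] := packing_form_inj (W j) (fun k => f (W i k)) _ _ _ _ _ _ (rf _ hj) (rf _ hi) wj _ ej _ eP.
- exact: wheel_motion.
- by rewrite -ei /curvatures !is_motion_curv.
apply/eqP; rewrite -(nth_uniq (t0, t0, t0) _ _ (enum_uniq (root_forms m))) -?cardE //.
apply/eqP; rewrite -/(t i) -/(t j) [t i]surjective_pairing [(t i).1]surjective_pairing.
rewrite [t j]surjective_pairing [(t j).1]surjective_pairing.
by congr (_, _, _); apply: val_inj; [case: e1|case: e2|case: e3].
Qed.

End FixedOuterCurvature.
End Packings.

Theorem theorem1p16 (R : realType) (n : nat) (hn : (0 < n)%N) :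
  exists N : nat,
    (packing_classes R (- n%:Z) #= `I_N)%card /\
    N%:R =
      (if odd n then
         n%:R / 2 * euler_factor n + 2 ^ ((omega (3 * n))%:Z - 2)
       else
         n%:R / 3 * euler_factor n + 2 ^ ((omega (3 * n %/ 2))%:Z - 1)) :> rat.
Proof.
case: n hn => // m _; exists #|root_forms m|; split.
  exact: packing_classes_card.
exact: (card_root_forms_formula m.+1).
Qed.
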